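(* Let $(R,G)$ be a marked elliptic root system belonging to a real vector space with a symmetric bilinear form of signature $(l,2,0)$, $l\ge1$, and assume that $R$ is non-reduced. Then $(R,G)$ is isomorphic, as a marked elliptic root system, to one of the following. 1. ($R/G$ of type $BCC_l$, $l\ge1$): $BCC_l^{(1)}$, $BCC_l^{(1)\ast_0}$, $BCC_l^{(1)\ast_{0'}}$, $BCC_l^{(2)}(1)$ ($l>1$), $BCC_l^{(2)}(2)$, $BCC_l^{(2)\ast_p}$ ($p\in\{0,1\}$), $BCC_l^{(4)}$. 2. ($R/G$ of type $C^\vee BC_l$, $l\ge1$): $C^\vee BC_l^{(1)}$, $C^\vee BC_l^{(2)}(1)$ ($l>1$), $C^\vee BC_l^{(2)}(2)$, $C^\vee BC_l^{(2)\ast_p}$ ($p\in\{0,1\}$), $C^\vee BC_l^{(4)}$, $C^\vee BC_l^{(4)\ast_0}$, $C^\vee BC_l^{(4)\ast_{0'}}$. 3. ($R/G$ of type $BB_l^\vee$, $l\ge2$): $BB_l^{\vee(1)}$, $BB_l^{\vee(2)}(1)$, $BB_l^{\vee(2)}(2)$, $BB_l^{\vee(4)}$, and for $l=2$ also $BB_2^{\vee(2)\ast}$. 4. ($R/G$ of type $C^\vee C_l$, $l\ge1$): $C^\vee C_l^{(1)}$, $C^\vee C_l^{(1)\ast_p}$ ($p\in\{0,1\}$), $C^\vee C_l^{(2)}(1)$ ($l>1$), $C^\vee C_l^{(2)}(2)$, $C^\vee C_l^{(2)\ast_s}$, $C^\vee C_l^{(2)\ast_l}$, $C^\vee C_l^{(2)\ast_0}$,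 $C^\vee C_l^{(2)\ast_1}$, $C^\vee C_l^{(2)\ast_{1'}}$, $C^\vee C_l^{(2)\diamond}$, $C^\vee C_l^{(4)}$, $C^\vee C_l^{(4)\ast_p}$ ($p\in\{0,1\}$).
   Context: Root systems. Let $F$ be a finite-dimensional real vector space with a symmetric bilinear form $I$. For $\alpha\in F$ with $I(\alpha,\alpha)\ne0$ put $\alpha^\vee=2\alpha/I(\alpha,\alpha)$ and $r_\alpha(\lambda)=\lambda-I(\alpha^\vee,\lambda)\alpha$. A root system belonging to $(F,I)$ is a subset $R\subset F\setminus\{0\}$ such that: (R1) the subgroup $Q(R)$ generated by $R$ is a full lattice in $F$; (R2) $I(\alpha,\alpha)\neq0$ for $\alpha\in R$; (R3) $r_\alpha(R)=R$ for $\alpha\in R$; (R4) $I(\alpha^\vee,\beta)\in\mathbb Z$ for $\alpha,\beta\in R$; (R5) if $R=R_1\sqcup R_2$ with $R_1\perp R_2$, then $R_1=\emptyset$ or $R_2=\emptyset$. $R$ is reduced if $\alpha,c\alpha\in R$ ($c\in\mathbb R$) implies $c=\pm1$, otherwise non-reduced. $R$ is elliptic if $I$ has signature $(l,2,0)$ ($l$ positive directions, $2$-dimensional radical, no negative direction), affine if the signature is $(l,1,0)$. A marked elliptic root system (mERS) is a pair $(R,G)$ with $R$ an elliptic root system and $G\subset\mathrm{rad}(I)$ a one-dimensional subspace such that $G\cap Q(R)$ has rank $1$. Its affine quotient $R/G$ is the image of $R$ in $F/G$, an affine root system for the induced form. Two mERSs $(R_1,G_1)$, $(R_2,G_2)$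 in $F_1,F_2$ are isomorphic if there is a linear isomorphism $\varphi:F_1\to F_2$ with $\varphi(R_1)=R_2$, $\varphi(G_1)=G_2$; root systems $R_1,R_2$ are isomorphic if there is a linear isomorphism with $\varphi(R_1)=R_2$. Put $B_s=\{\pm\varepsilon_i\}_{1\le i\le l}$, $B_m=\{\pm\varepsilon_i\pm\varepsilon_j\}_{1\le i<j\le l}$ (empty if $l=1$), $B_l=\{\pm2\varepsilon_i\}_{1\le i\le l}$, with $\varepsilon_1,\dots,\varepsilon_l$ orthonormal. Non-reduced affine root systems, in $\bigoplus_i\mathbb R\varepsilon_i\oplus\mathbb Rb$ with radical $\mathbb Rb$: $BCC_l=(B_s\cup B_m\cup B_l)+\mathbb Zb$; $C^\vee BC_l=(B_s+\mathbb Zb)\cup(B_m+2\mathbb Zb)\cup(B_l+4\mathbb Zb)$; $BB_l^\vee=(B_s+\mathbb Zb)\cup(B_m+\mathbb Zb)\cup(B_l+2\mathbb Zb)$; $C^\vee C_l=(B_s+\mathbb Zb)\cup(B_m+2\mathbb Zb)\cup(B_l+2\mathbb Zb)$. The listed elliptic types. In $F=\bigoplus_{i=1}^l\mathbb R\varepsilon_i\oplus\mathbb Rb\oplus\mathbb Ra$ with $\mathrm{rad}(I)=\mathbb Ra\oplus\mathbb Rb$, take $G=\mathbb Ra$ and $R=(B_s+S)\cup(B_m+L)\cup(B_l+E)$, where $S,L,E\subset\Lambda=\mathbb Za\oplus\mathbb Zb$. Write $L_{i,j}=\{ma+nb: m,n\in\mathbb Z,\ (m-i)(n-j)\equiv0\bmod2\}$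 and, for positive integers $s_1,s_2$, $L^{s_1,s_2}_{i,j}=\{s_2ma+s_1nb: m,n\in\mathbb Z,\ (m-i)(n-j)\equiv0\bmod2\}$. The triples $(S,L,E)$ are: $BCC_l^{(1)}$: $(\Lambda,\Lambda,\Lambda)$; $BCC_l^{(1)\ast_0}$: $(\Lambda,\Lambda,L_{0,0})$; $BCC_l^{(1)\ast_{0'}}$: $(\Lambda,\Lambda,L_{0,1})$; $BCC_l^{(2)}(1)$: $(\Lambda,\Lambda,2\mathbb Za+\mathbb Zb)$; $BCC_l^{(2)}(2)$: $(\Lambda,2\mathbb Za+\mathbb Zb,2\mathbb Za+\mathbb Zb)$; $BCC_l^{(2)\ast_p}$: $(\Lambda,2\mathbb Za+\mathbb Zb,L^{1,2}_{p,p})$; $BCC_l^{(4)}$: $(\Lambda,2\mathbb Za+\mathbb Zb,4\mathbb Za+\mathbb Zb)$. $C^\vee BC_l^{(1)}$: $(\Lambda,\mathbb Za+2\mathbb Zb,\mathbb Za+4\mathbb Zb)$; $C^\vee BC_l^{(2)}(1)$: $(\Lambda,\mathbb Za+2\mathbb Zb,2\mathbb Za+4\mathbb Zb)$; $C^\vee BC_l^{(2)}(2)$: $(\Lambda,2\Lambda,2\mathbb Za+4\mathbb Zb)$; $C^\vee BC_l^{(2)\ast_p}$: $(L_{p,p},2\Lambda,2\mathbb Za+4\mathbb Zb)$; $C^\vee BC_l^{(4)}$: $(\Lambda,2\Lambda,4\Lambda)$; $C^\vee BC_l^{(4)\ast_0}$: $(L_{0,0},2\Lambda,4\Lambda)$;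 $C^\vee BC_l^{(4)\ast_{0'}}$: $(L_{0,1},2\Lambda,4\Lambda)$. $BB_l^{\vee(1)}$: $(\Lambda,\Lambda,\mathbb Za+2\mathbb Zb)$; $BB_l^{\vee(2)}(1)$: $(\Lambda,\Lambda,2\Lambda)$; $BB_l^{\vee(2)}(2)$: $(\Lambda,2\mathbb Za+\mathbb Zb,2\Lambda)$; $BB_l^{\vee(4)}$: $(\Lambda,2\mathbb Za+\mathbb Zb,4\mathbb Za+2\mathbb Zb)$; $BB_2^{\vee(2)\ast}$ ($l=2$): $(\Lambda,L_{0,0},2\Lambda)$. $C^\vee C_l^{(1)}$: $(\Lambda,\mathbb Za+2\mathbb Zb,\mathbb Za+2\mathbb Zb)$; $C^\vee C_l^{(1)\ast_p}$: $(\Lambda,\mathbb Za+2\mathbb Zb,L^{2,1}_{p,p})$; $C^\vee C_l^{(2)}(1)$: $(\Lambda,\mathbb Za+2\mathbb Zb,2\Lambda)$; $C^\vee C_l^{(2)}(2)$: $(\Lambda,2\Lambda,2\Lambda)$; $C^\vee C_l^{(2)\ast_s}$: $(L_{0,0},2\Lambda,2\Lambda)$; $C^\vee C_l^{(2)\ast_l}$: $(\Lambda,2\Lambda,L^{2,2}_{0,0})$; $C^\vee C_l^{(2)\ast_0}$: $(L_{0,0},2\Lambda,L^{2,2}_{0,0})$; $C^\vee C_l^{(2)\ast_1}$: $(L_{0,0},2\Lambda,L^{2,2}_{1,1})$; $C^\vee C_l^{(2)\ast_{1'}}$: $(L_{0,0},2\Lambda,L^{2,2}_{1,0})$; $C^\vee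 C_l^{(2)\diamond}$: $(\Lambda,\mathbb Za+2\mathbb Zb,\{ma+2nb: m,n\in\mathbb Z,\ m\equiv n\bmod2\})$; $C^\vee C_l^{(4)}$: $(\Lambda,2\Lambda,4\mathbb Za+2\mathbb Zb)$; $C^\vee C_l^{(4)\ast_p}$: $(L_{p,p},2\Lambda,4\mathbb Za+2\mathbb Zb)$. *)

(* Defs.v *)
From HB Require Import structures.
From mathcomp Require Import all_boot all_order all_algebra.
From mathcomp Require Import sesquilinear.
From mathcomp Require Import boolp classical_sets reals.

Set Implicit Arguments.
Unset Strict Implicit.
Unset Printing Implicit Defensive.

Import Order.TTheory GRing.Theory Num.Theory.

Local Open Scope classical_set_scope.
Local Open Scope ring_scope.

Definition is_subgroup (V : zmodType) (A : set V) : Prop :=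
  A 0 /\ forall x y, A x -> A y -> A (x - y).

Definition generated_subgroup (V : zmodType) (A : set V) : set V :=
  smallest (@is_subgroup V) A.

Definition int_span (V : zmodType) (n : nat) (e : n.-tuple V) : set V :=
  [set x | exists c : 'I_n -> int, x = \sum_(i < n) e`_i *~ c i].

(* The set A is the Z-span of n vectors linearly independent over K; with
   n = dim F this says that A is a full lattice in F. *)
Definition is_lattice (K : realType) (F : vectType K) (A : set F) (n : nat)
    : Prop :=
  exists2 e : n.-tuple F, free e & A = int_span e.

Section RootSystems.
Variables (K : realType) (F : vectType K).
Implicit Types (I : {symmetric F}) (R : set F) (G : {vspace F}).

(* The arguments are the numbers of positive, zero and negative entries of an
   orthogonal basis, in this order. *)
Definition has_signature I (p z n : nat) : Prop :=
  exists e : (p + z + n).-tuple F,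
    [/\ basis_of fullv e,
        forall i j : 'I_(p + z + n), i != j -> I e`_i e`_j = 0
      & forall i : 'I_(p + z + n),
          [/\ (i < p)%N -> 0 < I e`_i e`_i,
              (p <= i < p + z)%N -> I e`_i e`_i = 0
            & (p + z <= i)%N -> I e`_i e`_i < 0]].

Definition radical I : {vspace F} := orthov I fullv.

Definition coroot I (x : F) : F := (2 / I x x) *: x.

Definition reflection I (x y : F) : F := y - I (coroot I x) y *: x.

Record root_system I R : Prop := RootSystem {
  root_neq0 : ~ R 0;
  root_lattice : is_lattice (generated_subgroup R) (\dim {:F});
  root_anisotropic : forall x, R x -> I x x != 0;
  root_reflection : forall x, R x -> reflection I x @` R = R;
  root_integral : forall x y, R x -> R y -> I (coroot I x) y \is a Num.int;
  root_irreducible : forall R1 R2 : set F,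
    R = R1 `|` R2 -> R1 `&` R2 = set0 ->
    (forall x y, R1 x -> R2 y -> I x y = 0) ->
    R1 = set0 \/ R2 = set0
}.

Definition reduced R : Prop :=
  forall (x : F) (c : K), R x -> R (c *: x) -> c = 1 \/ c = -1.

Definition elliptic_root_system (l : nat) I R : Prop :=
  root_system I R /\ has_signature I l 2 0.

Record marked_elliptic_root_system (l : nat) I R G : Prop := MERS {
  mers_elliptic : elliptic_root_system l I R;
  mers_sub_radical : (G <= radical I)%VS;
  mers_dim : \dim G = 1%N;
  mers_rank : is_lattice ([set x | x \in G] `&` generated_subgroup R) 1
}.

(* F / G, realized as the complement G^C of G, together with the projection
   along G. *)
Definition quotient_space G : vectType K := subvs_of (G^C)%VS.

Definition quotient_map G : F -> quotient_space G :=
  fun x => vsproj (G^C)%VS (daddv_pi (G^C)%VS G x).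

Definition quotient_roots R G : set (quotient_space G) :=
  quotient_map G @` R.

Lemma quotient_map_is_linear G : linear (quotient_map G).
Proof. by move=> c x y; rewrite /quotient_map !linearP. Qed.

Lemma quotient_map_eq0 G x : (quotient_map G x == 0) = (x \in G).
Proof.
have dxC : (G^C :&: G = 0)%VS by rewrite capvC capv_compl.
have xT : x \in (G^C + G)%VS by rewrite addvC addv_complf memvf.
have xE := daddv_pi_add dxC xT.
apply/eqP/idP => [q0|xG].
  have p0 : daddv_pi (G^C)%VS G x = 0.
    by rewrite -(vsprojK (memv_pi (G^C)%VS G x)) -/(quotient_map G x) q0.
  by rewrite -xE p0 add0r memv_pi.
have dx : (G :&: G^C = 0)%VS by rewrite capv_compl.
move: xE; rewrite (daddv_pi_id dx xG) => /(canRL (addrK _)).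
by rewrite subrr /quotient_map => ->; rewrite linear0.
Qed.

Lemma quotient_map_surj G (y : quotient_space G) : exists x, quotient_map G x = y.
Proof.
have dxC : (G^C :&: G = 0)%VS by rewrite capvC capv_compl.
by exists (vsval y); rewrite /quotient_map (daddv_pi_id dxC (subvsP y)) vsvalK.
Qed.

End RootSystems.

Arguments quotient_roots {K F} R G _.

Definition root_system_iso (K : realType) (F1 F2 : vectType K)
    (R1 : set F1) (R2 : set F2) : Prop :=
  exists2 phi : 'Hom(F1, F2), bijective phi & phi @` R1 = R2.

Definition mers_iso (K : realType) (F1 F2 : vectType K)
    (R1 : set F1) (G1 : {vspace F1}) (R2 : set F2) (G2 : {vspace F2}) : Prop :=
  exists phi : 'Hom(F1, F2),
    [/\ bijective phi, phi @` R1 = R2 & (phi @: G1 = G2)%VS].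

Definition set_sum (V : zmodType) (A B : set V) : set V :=
  [set x + y | x in A & y in B].

Section FiniteParts.
Variables (V : zmodType) (l : nat) (eps : 'I_l -> V).

Definition sgn (s : bool) (x : V) : V := if s then - x else x.

Definition B_s : set V :=
  [set x | exists (i : 'I_l) (s : bool), x = sgn s (eps i)].

Definition B_m : set V :=
  [set x | exists (i j : 'I_l) (s t : bool),
     (i < j)%N /\ x = sgn s (eps i) + sgn t (eps j)].

Definition B_l : set V :=
  [set x | exists (i : 'I_l) (s : bool), x = sgn s (eps i *+ 2)].

Definition roots_over (S L E : set V) : set V :=
  set_sum B_s S `|` set_sum B_m L `|` set_sum B_l E.

End FiniteParts.

(* The model spaces are spaces of row vectors, with coordinates in the basis
   eps_1, .., eps_l, b in the affine case and eps_1, .., eps_l, b, a in the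
   elliptic case. Isomorphisms of (marked) root systems are only required to be
   linear, so the forms on the model spaces are not needed. *)
Section AffineModels.
Variables (K : realType) (l : nat).

Definition affine_space : vectType K := 'rV[K]_(l + 1).

Definition aff_eps (i : 'I_l) : affine_space := delta_mx 0 (lshift 1 i).
Definition aff_b : affine_space := delta_mx 0 (rshift l 0).

Definition aff_Zb (k : int) : set affine_space :=
  [set x | exists n : int, x = aff_b *~ (k * n)].

Definition aff_BCC : set affine_space :=
  roots_over aff_eps (aff_Zb 1) (aff_Zb 1) (aff_Zb 1).
Definition aff_CvBC : set affine_space :=
  roots_over aff_eps (aff_Zb 1) (aff_Zb 2) (aff_Zb 4).
Definition aff_BBv : set affine_space :=
  roots_over aff_eps (aff_Zb 1) (aff_Zb 1) (aff_Zb 2).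
Definition aff_CvC : set affine_space :=
  roots_over aff_eps (aff_Zb 1) (aff_Zb 2) (aff_Zb 2).

End AffineModels.

Arguments aff_BCC : clear implicits.
Arguments aff_CvBC : clear implicits.
Arguments aff_BBv : clear implicits.
Arguments aff_CvC : clear implicits.

Section EllipticModels.
Variables (K : realType) (l : nat).

Definition elliptic_space : vectType K := 'rV[K]_(l + 2).

Definition ell_eps (i : 'I_l) : elliptic_space := delta_mx 0 (lshift 2 i).
Definition ell_b : elliptic_space := delta_mx 0 (rshift l 0).
Definition ell_a : elliptic_space := delta_mx 0 (rshift l 1).

(* A subset of the lattice Za + Zb is encoded by the set of the coordinate
   pairs (m, n) of its elements ma + nb. *)
Definition lattice_points (X : set (int * int)) : set elliptic_space :=
  [set ell_a *~ x.1 + ell_b *~ x.2 | x in X].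

Definition ell_roots (S L E : set (int * int)) : set elliptic_space :=
  roots_over ell_eps (lattice_points S) (lattice_points L) (lattice_points E).

Definition ell_marking : {vspace elliptic_space} := <[ell_a]>%VS.

End EllipticModels.

Arguments ell_roots : clear implicits.
Arguments ell_marking : clear implicits.

(* s2 Za + s1 Zb; the argument order is that of the coordinates (a, b) *)
Definition Zab (s2 s1 : int) : set (int * int) :=
  [set (s2 * x.1, s1 * x.2) | x in [set: int * int]].

Definition Lambda : set (int * int) := Zab 1 1.

(* L_{i,j}^{s1,s2}: here s1 scales b and s2 scales a *)
Definition Lss (s1 s2 i j : int) : set (int * int) :=
  [set (s2 * x.1, s1 * x.2) |
     x in [set x : int * int | (2 %| (x.1 - i) * (x.2 - j))%Z]].

Definition Lij (i j : int) : set (int * int) := Lss 1 1 i j.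

Definition Ldiamond : set (int * int) :=
  [set (x.1, 2 * x.2) | x in [set x : int * int | (x.1 = x.2 %[mod 2])%Z]].

(* The predicates below list the triples (S, L, E), in this order, for each type
   of the affine quotient. *)
Inductive BCC_triple (l : nat) :
    set (int * int) -> set (int * int) -> set (int * int) -> Prop :=
| BCC1 : BCC_triple l Lambda Lambda Lambda
| BCC1_star0 : BCC_triple l Lambda Lambda (Lij 0 0)
| BCC1_star0' : BCC_triple l Lambda Lambda (Lij 0 1)
| BCC2_1 : (1 < l)%N -> BCC_triple l Lambda Lambda (Zab 2 1)
| BCC2_2 : BCC_triple l Lambda (Zab 2 1) (Zab 2 1)
| BCC2_star (p : int) : p = 0 \/ p = 1 ->
    BCC_triple l Lambda (Zab 2 1) (Lss 1 2 p p)
| BCC4 : BCC_triple l Lambda (Zab 2 1) (Zab 4 1).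

Inductive CvBC_triple (l : nat) :
    set (int * int) -> set (int * int) -> set (int * int) -> Prop :=
| CvBC1 : CvBC_triple l Lambda (Zab 1 2) (Zab 1 4)
| CvBC2_1 : (1 < l)%N -> CvBC_triple l Lambda (Zab 1 2) (Zab 2 4)
| CvBC2_2 : CvBC_triple l Lambda (Zab 2 2) (Zab 2 4)
| CvBC2_star (p : int) : p = 0 \/ p = 1 ->
    CvBC_triple l (Lij p p) (Zab 2 2) (Zab 2 4)
| CvBC4 : CvBC_triple l Lambda (Zab 2 2) (Zab 4 4)
| CvBC4_star0 : CvBC_triple l (Lij 0 0) (Zab 2 2) (Zab 4 4)
| CvBC4_star0' : CvBC_triple l (Lij 0 1) (Zab 2 2) (Zab 4 4).

Inductive BBv_triple (l : nat) :
    set (int * int) -> set (int * int) -> set (int * int) -> Prop :=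
| BBv1 : BBv_triple l Lambda Lambda (Zab 1 2)
| BBv2_1 : BBv_triple l Lambda Lambda (Zab 2 2)
| BBv2_2 : BBv_triple l Lambda (Zab 2 1) (Zab 2 2)
| BBv4 : BBv_triple l Lambda (Zab 2 1) (Zab 4 2)
| BBv2_star : l = 2%N -> BBv_triple l Lambda (Lij 0 0) (Zab 2 2).

Inductive CvC_triple (l : nat) :
    set (int * int) -> set (int * int) -> set (int * int) -> Prop :=
| CvC1 : CvC_triple l Lambda (Zab 1 2) (Zab 1 2)
| CvC1_star (p : int) : p = 0 \/ p = 1 ->
    CvC_triple l Lambda (Zab 1 2) (Lss 2 1 p p)
| CvC2_1 : (1 < l)%N -> CvC_triple l Lambda (Zab 1 2) (Zab 2 2)
| CvC2_2 : CvC_triple l Lambda (Zab 2 2) (Zab 2 2)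
| CvC2_star_s : CvC_triple l (Lij 0 0) (Zab 2 2) (Zab 2 2)
| CvC2_star_l : CvC_triple l Lambda (Zab 2 2) (Lss 2 2 0 0)
| CvC2_star0 : CvC_triple l (Lij 0 0) (Zab 2 2) (Lss 2 2 0 0)
| CvC2_star1 : CvC_triple l (Lij 0 0) (Zab 2 2) (Lss 2 2 1 1)
| CvC2_star1' : CvC_triple l (Lij 0 0) (Zab 2 2) (Lss 2 2 1 0)
| CvC2_diamond : CvC_triple l Lambda (Zab 1 2) Ldiamond
| CvC4 : CvC_triple l Lambda (Zab 2 2) (Zab 4 2)
| CvC4_star (p : int) : p = 0 \/ p = 1 ->
    CvC_triple l (Lij p p) (Zab 2 2) (Zab 4 2).

Definition iso_to_listed (K : realType) (F : vectType K) (R : set F)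
    (G : {vspace F}) (l : nat)
    (listed : set (int * int) -> set (int * int) -> set (int * int) -> Prop)
    : Prop :=
  exists S L E, listed S L E /\
    mers_iso R G (ell_roots K l S L E) (ell_marking K l).

(* Main.v *)
From HB Require Import structures.
Require Import Defs.
From mathcomp Require Import all_boot all_order all_algebra.
From mathcomp Require Import sesquilinear.
From mathcomp Require Import boolp classical_sets reals.
From mathcomp Require Import zify ring lra.

Set Implicit Arguments.
Unset Strict Implicit.
Unset Printing Implicit Defensive.

Import Order.TTheory GRing.Theory Num.Theory.

Local Open Scope classical_set_scope.
Local Open Scope ring_scope.

(** The proof has a geometric half and a combinatorial half.

    Geometry. As R is non-reduced it contains some x together with 2x
    [nonreduced_pair]. Call doubled the roots of the same square length N as x
    whose double is a root modulo the radical. Integrality against that double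
    makes the product of a doubled root with any root an integral multiple of N,
    and since the form is positive semidefinite, two doubled roots are either
    orthogonal or equal up to sign modulo the radical [doubled_dichotomy].
    Reflections preserve doubled roots. Hence, by irreducibility, no root is
    orthogonal to a maximal orthogonal family e of doubled roots, and reflecting
    the e_i in a root b shows that b is +-e_i, +-2e_i or +-e_i+-e_j modulo the
    radical [maximal_form]: the classification of finite root systems is not
    needed. A second use of irreducibility connects all the indices, and the e_i
    are lifted to roots eps_i such that all 2eps_i and eps_i - eps_j are roots
    [frame_exists].

    The set of radical parts of the roots in the class of an element of B_s, B_m
    or B_l depends on neither the index nor the signs, so
    R = (B_s + S) u (B_m + L) u (B_l + E) with S, L, E in the radical
    [roots_decomposition], and reflections become closure properties of S, L, E.
    The group generated by S is the intersection of the root lattice with the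
    radical; it has a basis (a, b) in which a spans G [lattice_basis]. In these
    coordinates S, L, E are subsets of Z^2 [framed_compatible_exists].

    Combinatorics. Put Lambda = Z^2. Then S and L are unions of classes modulo
    2 Lambda and E is a union of classes modulo 4 Lambda; 0 lies in all three, S
    generates Lambda and S + L = S. Either L is Lambda, a sublattice of index 2 or
    2 Lambda, or l = 2 and L is the union of three classes; except when
    L = 2 Lambda, S is Lambda. In each case E is given by a table of four
    booleans (in the case of 2 Lambda so is S), and the changes of frame
    b |-> b + k a [framed_shear] and eps_i |-> eps_i - t_i [framed_shift] bring
    each table to a listed one [classify]. If l = 1 then L does not occur in R; it
    is then taken to be the group generated by E and 2 Lambda, which has all the
    required closure properties, so that the same case analysis applies and the
    types restricted to l > 1 are excluded.

    Finally the coordinates in the basis (eps, b, a) give the isomorphism with the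
    model, and dropping the coordinate of a gives the affine quotient
    [framed_iso_to_listed, framed_quotient_iso]. *)

(** * Symmetric forms of signature (l, 2, 0) *)

Section FormRules.
Variables (K : realType) (F : vectType K) (I : {symmetric F}).
Lemma sformC x y : I x y = I y x.
Proof. by rewrite hermC /= expr0 mul1r. Qed.
Lemma sformDl x y z : I (x + y) z = I x z + I y z. Proof. exact: linearDl. Qed.
Lemma sformDr x y z : I z (x + y) = I z x + I z y. Proof. exact: linearDr. Qed.
Lemma sformBl x y z : I (x - y) z = I x z - I y z. Proof. exact: linearBl. Qed.
Lemma sformBr x y z : I z (x - y) = I z x - I z y. Proof. exact: linearBr. Qed.
Lemma sformNl x z : I (- x) z = - I x z. Proof. exact: linearNl. Qed.
Lemma sformNr x z : I z (- x) = - I z x. Proof. exact: linearNr. Qed.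
Lemma sformZl c x z : I (c *: x) z = c * I x z. Proof. exact: linearZl_LR. Qed.
Lemma sformZr c x z : I z (c *: x) = c * I z x. Proof. exact: linearZr_LR. Qed.
Lemma sform0l z : I 0 z = 0. Proof. exact: linear0l. Qed.
Lemma sform0r z : I z 0 = 0. Proof. exact: linear0r. Qed.
Lemma sform_suml (T : Type) (r : seq T) (P : pred T) E z :
  I (\sum_(i <- r | P i) E i) z = \sum_(i <- r | P i) I (E i) z.
Proof. exact: linear_sumlz. Qed.
Lemma sform_sumr (T : Type) (r : seq T) (P : pred T) E z :
  I z (\sum_(i <- r | P i) E i) = \sum_(i <- r | P i) I z (E i).
Proof. exact: linear_sumr. Qed.
Definition sformE := (sformDl, sformDr, sformBl, sformBr, sformNl, sformNr,
  sformZl, sformZr, sform0l, sform0r).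

Lemma radP x : reflect (forall y, I x y = 0) (x \in radical I).
Proof.
apply: (iffP mem_orthovP) => [h y|h y _]; last exact: h.
by apply: h; rewrite memvf.
Qed.

Lemma rad0r x z : z \in radical I -> I x z = 0.
Proof. by move=> /radP h; rewrite sformC h. Qed.
Lemma rad0l x z : z \in radical I -> I z x = 0.
Proof. by move=> /radP h; rewrite h. Qed.

Lemma reflectionE x y : reflection I x y = y - (2 * I x y / I x x) *: x.
Proof. by rewrite /reflection /coroot sformZl mulrAC. Qed.

Section Sig.
Variables (l : nat) (hs : has_signature I l 2 0).

(** The form is diagonal in a basis whose first l vectors are the positive ones. *)
Lemma signature_orthogonal_basis : exists e : (l + 2 + 0).-tuple F,
   [/\ basis_of fullv e,
    forall x y, I x y = \sum_i coord e i x * coord e i y * I e`_i e`_i,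
    forall i : 'I_(l+2+0), (i < l)%N -> 0 < I e`_i e`_i
  & forall i : 'I_(l+2+0), ~~ (i < l)%N -> I e`_i e`_i = 0].
Proof.
case: hs => e [eb eo es]; exists e; split=> //.
- move=> x y; rewrite {1}(coord_basis eb (memvf x)) {1}(coord_basis eb (memvf y)).
  rewrite sform_suml; apply: eq_bigr => i _.
  rewrite sform_sumr (bigD1 i) //= big1 ?addr0; first by rewrite sformZl sformZr mulrA.
  by move=> j ji; rewrite sformZl sformZr eo ?mulr0 // eq_sym.
- by move=> i il; have [-> //] := es i.
- move=> i; rewrite -leqNgt => il; have [_ -> //] := es i.
  by rewrite il /=; case: (i) => m /=; rewrite addn0.
Qed.

Lemma form_ge0 x : 0 <= I x x.
Proof.
have [e [eb eI ep e0]] := signature_orthogonal_basis.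
rewrite eI sumr_ge0 // => i _; rewrite -expr2 mulr_ge0 ?sqr_ge0 //.
by have [/ep/ltW|/e0->] := boolP (i < l)%N.
Qed.

Lemma isotropic_radical x : I x x = 0 -> x \in radical I.
Proof.
have [e [eb eI ep e0]] := signature_orthogonal_basis.
move=> x0; apply/radP => y; rewrite eI big1 // => i _.
have [il|/e0->] := boolP (i < l)%N; last by rewrite mulr0.
suff : coord e i x * coord e i x * I e`_i e`_i = 0.
  by move/eqP; rewrite mulf_eq0 mulf_eq0 orbb (gt_eqF (ep _ il)) orbF => /eqP ->;
    rewrite !mul0r.
move: x0; rewrite eI => /psumr_eq0P -> // j _.
rewrite -expr2 mulr_ge0 ?sqr_ge0 //.
by have [/ep/ltW|/e0->] := boolP (j < l)%N.
Qed.

Lemma dim_signature : \dim {:F} = (l + 2)%N.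
Proof.
have [e [eb _ _ _]] := signature_orthogonal_basis.
have := basis_free eb; rewrite /free size_tuple (span_basis eb) addn0 => /eqP <-.
by [].
Qed.

Lemma dim_radical : \dim (radical I) = 2%N.
Proof.
have [e [eb eI ep e0]] := signature_orthogonal_basis.
have fr : free (drop l e).
  by have := basis_free eb; rewrite -{1}(cat_take_drop l e) => /catr_free.
suff -> : radical I = <<drop l e>>%VS.
  by move/eqP: fr => ->; rewrite size_drop size_tuple addn0 addKn.
have dl i : (drop l e)`_i = e`_(l + i) by rewrite nth_drop.
apply/vspaceP => x; apply/idP/idP => [/radP xr|].
  rewrite (coord_basis eb (memvf x)) memv_suml // => i _.
  have [il|il] := boolP (i < l)%N.
    have := xr e`_i; rewrite eI (bigD1 i) //= big1 ?addr0 => [|j ji].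
      rewrite coord_free ?(basis_free eb) // eqxx mulr1 => /eqP.
      by rewrite mulf_eq0 (gt_eqF (ep _ il)) orbF => /eqP ->; rewrite scale0r mem0v.
    by rewrite coord_free ?(basis_free eb) // eq_sym (negPf ji) mulr0 mul0r.
  rewrite memvZ // memv_span //.
  rewrite -leqNgt in il; rewrite -(subnKC il) -dl mem_nth // size_drop size_tuple.
  by rewrite ltn_sub2r // (leq_ltn_trans il).
suff : (<<drop l e>> <= radical I)%VS by move/subvP; apply.
apply/span_subvP => z /(nthP 0)[i]; rewrite size_drop size_tuple => il <-.
have li : (l + i < l + 2 + 0)%N by rewrite -ltn_subRL.
apply: isotropic_radical; rewrite dl.
by apply: (e0 (Ordinal li)); rewrite /= -leqNgt leq_addr.
Qed.
End Sig.
End FormRules.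

(** * Subgroups and vector identities *)

Section Subgroups.
Variable V : zmodType.
Implicit Types A X : set V.

Lemma generated_subgroup_min X A : is_subgroup A -> X `<=` A ->
  generated_subgroup X `<=` A.
Proof. by move=> sA XA x; apply. Qed.

Lemma sub_generated_subgroup X : X `<=` generated_subgroup X.
Proof. by move=> x Xx A [_]; apply. Qed.

Lemma generated_subgroupP X : is_subgroup (generated_subgroup X).
Proof.
split=> [A [[]]//|x y Gx Gy A hA].
by have [[_ h] _] := hA; apply: h; [apply: Gx | apply: Gy].
Qed.
End Subgroups.

Section SubgroupOps.
Variables (V : zmodType) (A : set V).
Hypothesis sA : is_subgroup A.

Lemma subgroup0 : A 0. Proof. by case: sA. Qed.
Lemma subgroupB x y : A x -> A y -> A (x - y). Proof. by case: sA => _; apply. Qed.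
Lemma subgroupN x : A x -> A (- x).
Proof. by move=> Ax; rewrite -sub0r; apply: subgroupB => //; exact: subgroup0. Qed.
Lemma subgroupD x y : A x -> A y -> A (x + y).
Proof. by move=> Ax Ay; rewrite -[y]opprK; apply: subgroupB => //;
  apply: subgroupN. Qed.
Lemma subgroupMn x n : A x -> A (x *+ n).
Proof.
move=> Ax; elim: n => [|n IHn]; first by rewrite mulr0n; exact: subgroup0.
by rewrite mulrS; apply: subgroupD.
Qed.
Lemma subgroupMz x n : A x -> A (x *~ n).
Proof.
move=> Ax; case: n => n; first exact: subgroupMn.
by rewrite NegzE mulrNz; apply: subgroupN; apply: subgroupMn.
Qed.
End SubgroupOps.

Section Vectors.
Variables (K : realType) (F : vectType K).

Lemma sgnZ (s : bool) (v : F) : sgn s v = ((-1) ^+ s : K) *: v.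
Proof. by case: s; rewrite /sgn /= ?expr1 ?scaleN1r // expr0 scale1r. Qed.

Lemma sgnN (s : bool) (v : F) : sgn (~~ s) v = - sgn s v.
Proof. by case: s; rewrite /= ?opprK. Qed.

Lemma memv_eq (V : {vspace F}) x y : x = y -> y \in V -> x \in V.
Proof. by move=> ->. Qed.

Lemma coord_inj (x y : F) :
  (forall i, coord (vbasis fullv) i x = coord (vbasis fullv) i y) -> x = y.
Proof.
move=> h; rewrite (coord_vbasis (memvf x)) (coord_vbasis (memvf y)).
by apply: eq_bigr => i _; rewrite h.
Qed.
End Vectors.

(** Vector identities with scalar, integral and sign coefficients reduce to ring
    identities between coordinates. *)
Ltac vring := apply: coord_inj => ?;
  rewrite ?sgnZ -?scaler_int ?mulr2n ?(linearD, linearN, linearZ_LR, linear0) /=;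
  ring.

(** * Doubled roots and maximal orthogonal families *)

Section RootFacts.
Variables (K : realType) (F : vectType K) (I : {symmetric F}) (R : set F).
Hypothesis hR : root_system I R.
Hypothesis I_ge0 : forall x, 0 <= I x x.
Hypothesis I_eq0 : forall x, I x x = 0 -> x \in radical I.

Lemma root_norm_gt0 x : R x -> 0 < I x x.
Proof. by move=> Rx; rewrite lt_def I_ge0 andbT (root_anisotropic hR). Qed.

Lemma root_refl x y : R x -> R y -> R (y - (2 * I x y / I x x) *: x).
Proof.
move=> Rx Ry; rewrite -reflectionE -[R](root_reflection hR Rx).
by exists y.
Qed.

(** Reflection in x when the Cartan number of x and y is known to be c. *)
Lemma root_reflE x y c : R x -> R y -> 2 * I x y = c * I x x -> R (y - c *: x).
Proof.
move=> Rx Ry e; have := root_refl Rx Ry.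
by rewrite e mulfK // gt_eqF // root_norm_gt0.
Qed.

Lemma root_opp x : R x -> R (- x).
Proof.
move=> Rx; have := root_reflE Rx Rx (erefl (2 * I x x)).
by rewrite scaler_nat mulr2n opprD addrA subrr add0r.
Qed.

Lemma root_sgn s x : R x -> R (sgn s x).
Proof. by case: s => //=; apply: root_opp. Qed.

Lemma root_int x y : R x -> R y -> exists n : int, 2 * I x y = n%:~R * I x x.
Proof.
move=> Rx Ry; have := root_integral hR Rx Ry.
rewrite /coroot sformZl => /intrP [n e]; exists n.
by rewrite -e mulrAC divfK // gt_eqF // root_norm_gt0.
Qed.

Lemma root_spanning (U : {vspace F}) : (forall x, R x -> x \in U) -> U = fullv.
Proof.
move=> RU; have [e ef eQ] := root_lattice hR.
have QU : generated_subgroup R `<=` [set x | x \in U].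
  apply: generated_subgroup_min => //; split=> /=; first exact: mem0v.
  by move=> x y xU yU; rewrite memvB.
have eb : basis_of fullv e.
  by rewrite basisEfree ef subvf size_tuple leqnn.
apply/eqP; rewrite eqEsubv subvf /= -(span_basis eb).
apply/span_subvP => x /tnthP [i ->]; apply: QU; rewrite eQ.
exists (fun j => (j == i)%:Z); rewrite (bigD1 i) //= eqxx mulr1z big1.
  by rewrite addr0 (tnth_nth 0).
by move=> j /negPf ->.
Qed.

(** If x and c x are roots then 2c and 2/c are integers with product 4, so that up to
    sign c is 1, 2 or 1/2. *)
Lemma nonreduced_pair : ~ reduced R -> exists x, R x /\ R (2 *: x).
Proof.
move=> /existsNP [x] /existsNP [c] /not_implyP [Rx] /not_implyP [Rcx].
move=> /not_orP [c1 cN1].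
have Ix := root_norm_gt0 Rx.
have [n] := root_int Rx Rcx; rewrite sformZr => nE.
have [m] := root_int Rcx Rx; rewrite !(sformZl,sformZr) => mE.
have c0 : c != 0.
  by apply/eqP => c0; apply: (@root_neq0 _ _ _ _ hR); rewrite c0 scale0r in Rcx.
have Ixn := lt0r_neq0 Ix.
have n2 : n%:~R = 2 * c :> K by apply: (mulIf Ixn); rewrite -nE; ring.
have m2 : m%:~R * c = 2 :> K.
  by apply: (mulIf (mulf_neq0 c0 Ixn)); rewrite mE; ring.
have nm : n * m = 4.
  by apply/eqP; rewrite -(eqr_int K) intrM n2; apply/eqP;
    rewrite -mulrA (mulrC c) m2; ring.
have nz : (n = 1 \/ n = -1) \/ (n = 4 \/ n = -4).
  have n0 : n != 0 by apply/eqP=> n0; rewrite n0 mul0r in nm.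
  have nn2 : n != 2.
    by apply/eqP => n_; apply: c1; move: n2; rewrite n_ => n2; lra.
  have nnN2 : n != -2.
    by apply/eqP => n_; apply: cN1; move: n2; rewrite n_ => n2; lra.
  have nd : (`|n| %| 4)%N by apply/dvdnP; exists `|m|%N; rewrite mulnC -abszM nm.
  have : `|n|%N \in divisors 4 by rewrite -dvdn_divisors.
  rewrite !inE => /or3P[] /eqP h; lia.
case: nz => [] [] n_; rewrite n_ in n2.
- exists (c *: x); split=> //; suff -> : 2 *: (c *: x) = x by [].
  by rewrite scalerA -n2 scale1r.
- exists (- (c *: x)); split; first exact: root_opp.
  suff -> : 2 *: (- (c *: x)) = x by [].
  by rewrite scalerN scalerA -n2 scaleN1r opprK.
- exists x; split=> //; suff -> : 2 = c by [].
  by move: n2 => ?; lra.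
- exists x; split=> //; suff -> : 2 = - c by rewrite scaleNr; apply: root_opp.
  by move: n2 => ?; lra.
Qed.

Section Family.
Variable N : K.

(** Roots of square length N of which twice is a root modulo the radical. *)
Definition doubled x := [/\ R x, I x x = N
   & exists2 z, z \in radical I & R (2 *: x + z)].

Lemma doubled_gt0 x : doubled x -> 0 < N.
Proof. by case=> Rx <- _; apply: root_norm_gt0. Qed.

(** The Cartan integer of 2x + z and y is half that of x and y. *)
Lemma doubled_even x y : doubled x -> R y -> exists n : int, I x y = n%:~R * N.
Proof.
move=> Dx Ry; have N0 := doubled_gt0 Dx; case: Dx => Rx IN [z zr R2].
have [n] := root_int R2 Ry; rewrite !sformE !(rad0l _ zr, rad0r _ zr) IN => e.
by exists n; lra.
Qed.

Lemma doubled_refl x y c : doubled x -> R y -> 2 * I y x = c * I y y ->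
  doubled (x - c *: y).
Proof.
move=> [Rx IN [z zr R2]] Ry e; split; first exact: root_reflE.
- have e2 : c * (2 * I y x) = c * (c * I y y) by rewrite e.
  by rewrite !sformE IN (sformC I x y); lra.
- exists z => //.
  suff -> : 2 *: (x - c *: y) + z = (2 *: x + z) - (2 * c) *: y.
    by apply: root_reflE => //; rewrite !sformE (rad0r _ zr); lra.
  by rewrite scalerBr scalerA addrAC.
Qed.

Lemma doubled_dichotomy x y : doubled x -> doubled y ->
  I x y = 0 \/ exists s, y - sgn s x \in radical I.
Proof.
move=> Dx Dy; have N0 := doubled_gt0 Dx; have [Ry Iy _] := Dy.
have [n nE] := doubled_even Dx Ry; have [_ Ix _] := Dx.
have := I_ge0 (y - x); have := I_ge0 (y + x);
  rewrite !sformE (sformC I y x) !nE !Ix !Iy => h1 h2.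
have [n1 n2] : n <= 1 /\ -1 <= n.
  split; rewrite -(ler_int K); rewrite -(ler_pM2r N0) ?mulrNz; lra.
have [n0|[n0|n0]] : n = 0 \/ n = 1 \/ n = -1 by lia.
- by left; rewrite n0 mul0r.
- right; exists false; apply: I_eq0.
  by rewrite /= !sformE (sformC I y x) nE Ix Iy n0; lra.
- right; exists true; apply: I_eq0.
  by rewrite /= !sformE (sformC I y x) nE Ix Iy n0; lra.
Qed.

(** Families of pairwise orthogonal doubled roots *)
Definition orth_family k (e : 'I_k -> F) :=
  (forall i, doubled (e i)) /\ (forall i j, i != j -> I (e i) (e j) = 0).

Lemma orth_familyE k (e : 'I_k -> F) : orth_family e ->
  forall i j, I (e i) (e j) = (i == j)%:R * N.
Proof.
move=> [De oe] i j; have [->|ij] := eqVneq i j; last by rewrite oe // mul0r.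
by have [_ -> _] := De j; rewrite mul1r.
Qed.

Lemma orth_family_coef k (e : 'I_k -> F) (c : 'I_k -> K) j : orth_family e ->
  I (\sum_i c i *: e i) (e j) = c j * N.
Proof.
move=> oe; rewrite sform_suml (bigD1 j) //= big1 => [|i ij].
  by rewrite sformZl orth_familyE // eqxx mul1r addr0.
by rewrite sformZl orth_familyE // (negPf ij) mul0r mulr0.
Qed.

(** An orthogonal family is free and its span meets the radical trivially. *)
Lemma orth_family_direct k (e : 'I_k -> F) : orth_family e ->
  \dim (<<[tuple e i | i < k]>> + radical I) = (k + \dim (radical I))%N.
Proof.
move=> oe; set E := [tuple e i | i < k].
have EE (i : 'I_k) : E`_i = e i by rewrite -tnth_nth tnth_mktuple.
have fE : free E.
  apply/freeP => c c0 j; have [De _] := oe; have N0 := doubled_gt0 (De j).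
  have : c j * N = 0.
    rewrite -(orth_family_coef c j oe).
    rewrite (eq_bigr (fun i => c i *: E`_i)) ?c0 ?sform0l // => i _.
    by rewrite EE.
  by move/eqP; rewrite mulf_eq0 (gt_eqF N0) orbF => /eqP.
rewrite dimv_disjoint_sum; last first.
  apply/eqP; rewrite -subv0; apply/subvP => x; rewrite memv_cap => /andP[xE xr].
  rewrite (coord_span xE) big1 ?mem0v // => j _; have [De _] := oe.
  have N0 := doubled_gt0 (De j).
  have : coord E j x * N = 0.
    rewrite -(orth_family_coef (fun i => coord E i x) j oe).
    rewrite -(rad0l (e j) xr); congr (I _ _); rewrite {2}(coord_span xE).
    by apply: eq_bigr => i _; rewrite EE.
  by move/eqP; rewrite mulf_eq0 (gt_eqF N0) orbF => /eqP ->; rewrite scale0r.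
by move/eqP: fE => ->; rewrite size_tuple.
Qed.

Lemma maximal_family x0 : doubled x0 -> exists k (e : 'I_k -> F), orth_family e /\
  forall x, doubled x -> exists i s, x - sgn s (e i) \in radical I.
Proof.
move=> D0; pose P k := `[< exists e : 'I_k -> F, orth_family e >].
have P0 : exists k, P k.
  by exists 0%N; apply/asboolP; exists (fun _ => 0); split; case.
have Pd k : P k -> (k <= \dim {:F})%N.
  move/asboolP=> [e oe];
    apply: leq_trans (dimvS (subvf (<<[tuple e i | i < k]>> + radical I))).
  by rewrite orth_family_direct // leq_addr.
case: (ex_maxnP P0 Pd) => k /asboolP [e oe] mx; exists k, e; split=> // x Dx.
apply: contrapT => nx.
have xo i : I x (e i) = 0.
  have [De _] := oe; have [] := doubled_dichotomy (De i) Dx; first by rewrite sformC.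
  by move=> [s sr]; case: nx; exists i, s.
suff : P k.+1 by move/mx; rewrite ltnn.
apply/asboolP; exists (fun i => if unlift ord0 i is Some j then e j else x).
have [De oee] := oe; split=> [i|i j]; first by case: unliftP => [j|] _.
case: (unliftP ord0 i) => [i'|] ->; case: (unliftP ord0 j) => [j'|] -> ij //.
- by apply: oee; apply: contraNneq ij => ->.
- by rewrite sformC.
Qed.

End Family.

Lemma int_mul_eq2 (n m : int) : n * m = 2 -> [\/ n = 1 /\ m = 2, n = -1 /\ m = -2,
  n = 2 /\ m = 1 | n = -2 /\ m = -1].
Proof.
move=> nm.
have nd : (`|n| %| 2)%N by apply/dvdnP; exists `|m|%N; rewrite mulnC -abszM nm.
have : `|n|%N \in divisors 2 by rewrite -dvdn_divisors.
rewrite !inE => /orP[] /eqP h.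
- have [n1|n1] : n = 1 \/ n = -1 by lia.
    by constructor 1; lia.
  by constructor 2; lia.
- have [n1|n1] : n = 2 \/ n = -2 by lia.
    by constructor 3; lia.
  by constructor 4; lia.
Qed.

Section Forms.
Variables (N : K) (k : nat) (e : 'I_k -> F).
Hypothesis oe : orth_family N e.
Hypothesis me : forall x, doubled N x -> exists i s, x - sgn s (e i) \in radical I.
Hypothesis k0 : (0 < k)%N.

Let De i : doubled N (e i). Proof. by case: oe. Qed.
Let N0 : 0 < N. Proof. exact: doubled_gt0 (De (Ordinal k0)). Qed.
Let eE i j : I (e i) (e j) = (i == j)%:R * N. Proof. exact: orth_familyE. Qed.

(** The roots orthogonal to a maximal family e are orthogonal to all other roots: if
    b is not orthogonal to e_i, the reflection in b maps e_i to some +-e_j modulo the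
    radical, so b lies in the span of e modulo the radical. By irreducibility there
    are none. *)
Lemma maximal_not_orthogonal b : R b -> exists i, I (e i) b != 0.
Proof.
pose R1 := [set b | R b /\ exists i, I (e i) b != 0].
pose R2 := [set b | R b /\ forall i, I (e i) b = 0].
have [] := @root_irreducible _ _ _ _ hR R1 R2.
- apply/seteqP; split => [x Rx|x [[]|[]] //].
  have [h|h] := pselect (exists i, I (e i) x != 0); first by left.
  right; split=> // i; apply/eqP; apply: contrapT => /negP h'; apply: h.
  by exists i.
- by apply/seteqP; split => [x [[_ [i /eqP +]] [_ ]]|//] => + h; rewrite h.
- move=> x y [Rx [i nx]] [Ry oy].
  pose c := 2 * I x (e i) / I x x.
  have Ix := lt0r_neq0 (root_norm_gt0 Rx).
  have cE : 2 * I x (e i) = c * I x x by rewrite divfK.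
  have c0 : c != 0.
      by rewrite /c !mulf_eq0 !negb_or invr_eq0 pnatr_eq0 Ix sformC nx.
  have [j [s jr]] := me (doubled_refl (De i) Rx cE).
  have := rad0l y jr; rewrite sgnZ !sformE !oy => h.
  by move/eqP: h; rewrite mulr0 subr0 sub0r oppr_eq0 mulf_eq0 (negPf c0) => /eqP.
- move=> R10; have : R1 (e (Ordinal k0)).
    by split; [case: (De (Ordinal k0))|exists (Ordinal k0);
      rewrite eE eqxx mul1r gt_eqF].
  by rewrite R10.
- move=> R20 Rb; apply: contrapT => nb; suff : R2 b by rewrite R20.
  by split=> // i; apply/eqP; apply: contrapT => /negP h; apply: nb; exists i.
Qed.

(** The vectors of the finite root system BC_k with orthogonal basis e *)
Definition bc_form (v : F) := exists i,
  [\/ exists s, v = sgn s (e i), exists s, v = sgn s (e i *+ 2)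
    | exists j s t, i != j /\ v = sgn s (e i) + sgn t (e j)].

(** With n the Cartan integer of b and e_i, and s e_j the image of e_i under the
    reflection in b, n b = e_i - s e_j modulo the radical; the coefficient m of b at
    e_i is integral, and n m is 1 if i != j and 2 if i = j. *)
Lemma maximal_form b : R b -> exists v, bc_form v /\ b - v \in radical I.
Proof.
move=> Rb; have [i ni] := maximal_not_orthogonal Rb.
have [m mE] := doubled_even (De i) Rb.
have [n nE] := root_int Rb (let: And3 h _ _ := De i in h).
have [j [s jr]] := me (doubled_refl (De i) Rb nE).
have n0 : n != 0.
  apply/eqP => n0; move/eqP: nE; rewrite n0 mul0r mulf_eq0 sformC (negPf ni).
  by rewrite pnatr_eq0.
have n0' : n%:~R != 0 :> K by rewrite intr_eq0.
have := rad0r (e i) jr; rewrite sgnZ !sformE !eE eqxx /= mulr1n mE => h.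
have [ij|ij] := eqVneq i j; last first.
  rewrite (negPf ij) mul0r mulr0 subr0 in h.
  have nm : n * m = 1.
    apply/eqP; rewrite -(eqr_int K) intrM; apply/eqP; apply: (mulIf (lt0r_neq0 N0)).
    by rewrite -mulrA mul1r; lra.
  have [n1|n1] : n = 1 \/ n = -1.
    have nd : (`|n| %| 1)%N by apply/dvdnP; exists `|m|%N; rewrite mulnC -abszM nm.
    by move: nd; rewrite dvdn1 => /eqP; lia.
  - exists (sgn false (e i) + sgn (~~ s) (e j)); split.
      by exists i; constructor 3; exists j, false, (~~ s).
    rewrite -memvN; apply: (memv_eq _ jr).
    by rewrite n1 scale1r sgnN /= opprB addrAC.
  - exists (sgn true (e i) + sgn s (e j)); split.
      by exists i; constructor 3; exists j, true, s.
    apply: (memv_eq _ jr).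
    by rewrite n1 mulrNz scaleN1r /= opprK opprD opprK addrA (addrC b).
rewrite -{}ij in jr h; rewrite eqxx /= mulr1n in h.
case: s jr h => jr h; last first.
  case/negP: (lt0r_neq0 (root_norm_gt0 Rb)).
  suff br : b \in radical I by rewrite (rad0l _ br).
  move: jr; rewrite /= addrAC subrr add0r memvN => jr.
  by move: (memvZ (n%:~R^-1) jr); rewrite scalerA mulVf // scale1r.
have nm : n * m = 2.
  apply/eqP; rewrite -(eqr_int K) intrM; apply/eqP; apply: (mulIf (lt0r_neq0 N0)).
  by rewrite -mulrA; move: h; rewrite expr1; lra.
rewrite /= opprK in jr.
have jr2 : n%:~R *: b - e i *+ 2 \in radical I.
  rewrite -memvN; apply: (memv_eq _ jr).
  by rewrite opprB mulr2n addrAC.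
have [[n1 _]|[n1 _]|[n1 _]|[n1 _]] := int_mul_eq2 nm.
- exists (sgn false (e i *+ 2)); split; first by exists i; constructor 2; exists false.
  by move: jr2; rewrite n1 scale1r.
- exists (sgn true (e i *+ 2)); split; first by exists i; constructor 2; exists true.
  rewrite -memvN; apply: (memv_eq _ jr2).
  by rewrite n1 mulrNz scaleN1r /= opprK opprD.
- exists (sgn false (e i)); split; first by exists i; constructor 1; exists false.
  move: (memvZ 2^-1 jr2); rewrite n1 scalerBr scalerA mulVf ?pnatr_eq0 // scale1r.
  by rewrite -scaler_nat scalerA mulVf ?pnatr_eq0 // scale1r.
- exists (sgn true (e i)); split; first by exists i; constructor 1; exists true.
  rewrite -memvN; move: (memvZ 2^-1 jr2); rewrite n1 scalerBr scalerA mulrNz mulrN.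
  rewrite mulVf ?pnatr_eq0 // scaleN1r -scaler_nat scalerA mulVf ?pnatr_eq0 // scale1r.
  by rewrite /= opprK opprD.
Qed.

End Forms.
End RootFacts.

(** * Frames *)

Section Frame.
Variables (K : realType) (F : vectType K) (I : {symmetric F}) (R : set F).

(** A frame: orthogonal vectors eps_i of square length N such that eps_i, 2eps_i and
    eps_i - eps_j are roots, not only modulo the radical, and every root is a vector
    of BC_l modulo the radical. *)
Record is_frame (l : nat) (N : K) (eps : 'I_l -> F) : Prop := IsFrame {
  frame_gt0 : 0 < N;
  frame_orth : forall i j, I (eps i) (eps j) = (i == j)%:R * N;
  frame_short : forall i, R (eps i);
  frame_long : forall i, R (2 *: eps i);
  frame_middle : forall i j, i != j -> R (eps i - eps j);
  frame_form : forall b, R b -> exists v, bc_form eps v /\ b - v \in radical I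
}.

Hypothesis hR : root_system I R.
Hypothesis I_ge0 : forall x, 0 <= I x x.
Hypothesis I_eq0 : forall x, I x x = 0 -> x \in radical I.

Let root_norm_gt0 := root_norm_gt0 hR I_ge0.
Let root_reflE := root_reflE hR I_ge0.
Let root_sgn := root_sgn hR I_ge0.

Lemma signr_sq (s : bool) : (-1) ^+ s * (-1) ^+ s = 1 :> K.
Proof. by rewrite -expr2 sqrr_sign. Qed.

Lemma frame_exists l : \dim {:F} = (l + 2)%N -> \dim (radical I) = 2%N ->
  ~ reduced R -> exists N (eps : 'I_l -> F), is_frame N eps.
Proof.
move=> dF dr nR.
have [x0 [Rx0 R2x0]] := nonreduced_pair hR I_ge0 nR.
pose N := I x0 x0.
have D0 : doubled I R N x0.
  by split=> //; exists 0; rewrite ?mem0v ?addr0.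
have N0 : 0 < N := root_norm_gt0 Rx0.
have [k [e [oe me]]] := maximal_family hR I_ge0 I_eq0 D0.
have [i0 [s0 x0r]] := me _ D0.
have k0 : (0 < k)%N by case: k i0 {e oe me x0r} => [[]|].
have form := maximal_form hR I_ge0 oe me k0.
have kl : k = l.
  have := orth_family_direct hR I_ge0 oe.
  set E := [tuple e i | i < k].
  have eE i : e i \in <<E>>%VS.
    by have := mem_tnth i E; rewrite tnth_mktuple => /memv_span.
  suff -> : (<<E>> + radical I)%VS = fullv by rewrite dF dr => /addIn ->.
  apply: (root_spanning hR) => b /form [v [vf br]].
  rewrite -(subrK v b) addrC memv_add //.
  case: vf => i [[s ->]|[s ->]|[j [s [t [_ ->]]]]].
  - by rewrite sgnZ memvZ.
  - by rewrite sgnZ memvZ // mulr2n memvD.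
  - by rewrite !sgnZ memvD // memvZ.
subst k.
have eE i j : I (e i) (e j) = (i == j)%:R * N by rewrite (orth_familyE oe).
have De i : doubled I R N (e i) by case: oe.
(* [mid i s j t b]: modulo the radical, b is the middle vector +-e_i +- e_j with
   signs given by s and t. *)
pose mid i s j t b := b - (sgn s (e i) + sgn t (e j)) \in radical I.
have midI i s j t b x : mid i s j t b ->
    I b x = (-1) ^+ s * I (e i) x + (-1) ^+ t * I (e j) x.
  by move=> /(rad0l x); rewrite !sgnZ !sformE => h; lra.
have midN i s j t b : i != j -> mid i s j t b -> I b b = 2 * N.
  move=> ij h; rewrite (midI _ _ _ _ _ _ h) ![I (e _) b]sformC !(midI _ _ _ _ _ _ h).
  rewrite !eE !eqxx eq_sym (negPf ij) /= !mulr1n !mul0r !mulr0 add0r addr0.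
  by rewrite !mulrA !signr_sq; lra.
have midC i s j t b : mid i s j t b -> mid j t i s b.
  by rewrite /mid (addrC (sgn s _)).
(* J is the set of the indices linked to i0 by a middle root. *)
pose J i := i = i0 \/ exists b s t, R b /\ mid i0 s i t b.
have J0 : J i0 by left.
have Jstep i s j t b : i != j -> R b -> mid i s j t b -> J i -> J j.
  move=> ij Rb bm Ji; have [->//|j0] := eqVneq j i0.
  have [ii0|i_i0] := eqVneq i i0; first by right; exists b, s, t; rewrite -ii0.
  case: Ji => [|[b' [s' [t' [Rb' bm']]]]]; first by move/eqP; rewrite (negPf i_i0).
  pose c : K := (-1) ^+ s * (-1) ^+ t'.
  right; exists (b' - c *: b), s', (~~ (s (+) t' (+) t)); split.
    apply: root_reflE => //; rewrite (midN _ _ _ _ _ ij bm) (midI _ _ _ _ _ _ bm).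
    rewrite ![I (e _) b']sformC !(midI _ _ _ _ _ _ bm') !eE eqxx ![i0 == _]eq_sym.
    rewrite (negPf i_i0) (negPf j0) (negPf ij) /= mulr1n /c; ring.
  rewrite /mid; have -> : b' - c *: b - (sgn s' (e i0) + sgn (~~ (s (+) t' (+) t))
    (e j)) =
     (b' - (sgn s' (e i0) + sgn t' (e i))) - c *: (b - (sgn s (e i) + sgn t (e j))).
    rewrite sgnN !sgnZ !signr_addb -/c.
    have -> : (-1) ^+ t' = c * (-1) ^+ s.
      by rewrite /c mulrAC signr_sq mul1r.
    vring.
  by rewrite memvB // memvZ.
(* The roots that involve an index in J are orthogonal to those that do not. *)
have J_all i : J i.
  pose R1 := [set b | R b /\ exists2 i, J i & I (e i) b != 0].
  pose R2 := [set b | R b /\ forall i, J i -> I (e i) b = 0].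
  have [] := @root_irreducible _ _ _ _ hR R1 R2.
  - apply/seteqP; split => [x Rx|x [[]|[]] //].
    have [h|h] := pselect (exists2 i, J i & I (e i) x != 0); first by left.
    right; split=> // j Jj; apply/eqP; apply: contrapT => /negP h'; apply: h.
    by exists j.
  - by apply/seteqP; split => [x [[_ [j Jj /eqP +]] [_ ]]|//] => + h; rewrite h.
  - move=> x y [Rx [j Jj nx]] [Ry oy].
    have [v [[i1 vf] xv]] := form x Rx.
    have xy w : I x w = I v w.
      by have := rad0l w xv; rewrite !sformE => /eqP; rewrite subr_eq0 => /eqP.
    rewrite xy; rewrite sformC xy in nx.
    case: vf => [[s v_]|[s v_]|[j1 [s [t [ij v_]]]]]; move: nx xv; rewrite {}v_ !sgnZ.
    + rewrite !sformE eE; have [i1j|_] := eqVneq i1 j; last by rewrite mul0r mulr0 eqxx.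
      by rewrite oy ?mulr0 // i1j.
    + rewrite mulr2n !sformE !eE; have [i1j|_] := eqVneq i1 j;
      last by rewrite mul0r addr0 mulr0 eqxx.
      by rewrite oy ?addr0 ?mulr0 // i1j.
    + rewrite !sformE !eE -!sgnZ => nx xv.
      have xm : mid i1 s j1 t x by [].
      have [Ji1|nJ] := pselect (J i1).
        by rewrite !oy ?mulr0 ?addr0 //; apply: Jstep Rx xm Ji1.
      have [Jj1|nJ'] := pselect (J j1).
        by case: nJ; apply: Jstep Rx (midC _ _ _ _ _ xm) Jj1; rewrite eq_sym.
      case/eqP: nx; have [ij1|_] := eqVneq i1 j; first by case: nJ; rewrite ij1.
      have [jj1|_] := eqVneq j1 j; first by case: nJ'; rewrite jj1.
      by rewrite mul0r !mulr0 addr0.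
  - move=> R10; have : R1 (e i0).
      by split; [case: (De i0)|exists i0 => //; rewrite eE eqxx mul1r gt_eqF].
    by rewrite R10.
  - move=> R20; apply: contrapT => nJ.
    suff : R2 (e i) by rewrite R20.
    split; first by case: (De i).
    move=> j Jj; rewrite eE; have [ji|_] := eqVneq j i; last by rewrite mul0r.
    by case: nJ; rewrite -ji.
(* For j != i0, a root b linking i0 and j reflects x0 to a lift of +-e_j, and it
   reflects 2x0 to twice this lift. *)
have lift_ex j : exists p : F * bool, [/\ R p.1, R (2 *: p.1),
    p.1 - sgn p.2 (e j) \in radical I & if j == i0 then p.1 = x0 else R (x0 - p.1)].
  have [->|ji0] := eqVneq j i0; first by exists (x0, s0).
  case: (J_all j) => [/eqP|[b [s [t [Rb bm]]]]]; first by rewrite (negPf ji0).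
  rewrite eq_sym in ji0.
  pose c : K := (-1) ^+ (s0 (+) s).
  have bx : 2 * I b x0 = c * I b b.
    rewrite (midN _ _ _ _ _ ji0 bm) (midI _ _ _ _ _ _ bm).
    rewrite ![I (e _) x0]sformC.
    have x0E y : I x0 y = (-1) ^+ s0 * I (e i0) y.
      by have := rad0l y x0r; rewrite sgnZ !sformE => h; lra.
    rewrite !x0E !eE eqxx (negPf ji0) /= mulr1n /c signr_addb; ring.
  exists (x0 - c *: b, ~~ (s0 (+) s (+) t)); split=> /=.
  - exact: root_reflE.
  - have -> : 2 *: (x0 - c *: b) = 2 *: x0 - (2 * c) *: b by rewrite scalerBr scalerA.
    by apply: root_reflE => //; rewrite sformZr mulrCA bx mulrA.
  - have -> : x0 - c *: b - sgn (~~ (s0 (+) s (+) t)) (e j) =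
      (x0 - sgn s0 (e i0)) - c *: (b - (sgn s (e i0) + sgn t (e j))).
      rewrite sgnN !sgnZ (signr_addb _ (s0 (+) s) t) -/c.
      have -> : (-1) ^+ s0 = c * (-1) ^+ s.
        by rewrite /c signr_addb -mulrA signr_sq mulr1.
      vring.
    by rewrite memvB // memvZ.
  - rewrite opprB addrC subrK /c -sgnZ.
    exact: root_sgn.
have [eps_ epsP] := choice lift_ex.
pose eps i := (eps_ i).1; pose sg i := (eps_ i).2.
have eps_r i : eps i - sgn (sg i) (e i) \in radical I by case: (epsP i).
have eps_l i x : I (eps i) x = (-1) ^+ (sg i) * I (e i) x.
  by have := rad0l x (eps_r i); rewrite sgnZ !sformE => h'; lra.
have epsE i j : I (eps i) (eps j) = (i == j)%:R * N.
  rewrite eps_l sformC eps_l eE eq_sym; have [->|_] := eqVneq i j.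
    by rewrite mulrA signr_sq !mul1r.
  by rewrite !mul0r !mulr0.
have eps0 : eps i0 = x0 by case: (epsP i0) => _ _ _; rewrite eqxx.
have epsd i : i != i0 -> R (eps i0 - eps i).
  by move=> ii; case: (epsP i) => _ _ _; rewrite (negPf ii) eps0.
exists N, eps; split => //.
- by move=> i; case: (epsP i).
- by move=> i; case: (epsP i).
- move=> i j ij; have [ii|ii] := eqVneq i i0.
    by rewrite ii; apply: epsd; rewrite -ii eq_sym.
  have [jj|jj] := eqVneq j i0.
    by rewrite jj -opprB; apply: (root_opp hR I_ge0); apply: epsd.
  have -> : eps i - eps j = (eps i0 - eps j) - 1 *: (eps i0 - eps i) by vring.
  apply: (root_reflE (epsd _ ii) (epsd _ jj));
    rewrite !sformE !epsE !eqxx ![i0 == _]eq_sym.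
  by rewrite (negPf ii) (negPf jj) (negPf ij) /= !mulr1n; ring.
- move=> b /form [v [[i vf] bv]].
  have sub j s c : exists2 z, z \in radical I & sgn s (c *: e j) = sgn (s (+) sg j)
    (c *: eps j) + z.
    exists ((- (-1) ^+ (s (+) sg j) * c) *: (eps j - sgn (sg j) (e j)));
      first exact: memvZ.
    rewrite !sgnZ signr_addb scalerBr !scalerA.
    have -> : - ((-1) ^+ s * (-1) ^+ sg j) * c * (-1) ^+ sg j = - (-1) ^+ s * c :> K.
      transitivity (- (-1) ^+ s * c * ((-1) ^+ sg j * (-1) ^+ sg j) : K); first by ring.
      by rewrite signr_sq mulr1.
    vring.
  have sub1 j s : exists2 z, z \in radical I & sgn s (e j) = sgn (s (+) sg j) (eps
    j) + z.
    by have [z zr] := sub j s 1; rewrite !scale1r; exists z.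
  have dec v' w z : b - v' \in radical I -> v' = w + z -> z \in radical I -> b - w
    \in radical I.
    move=> + vE zr; rewrite vE => h.
    have -> : b - w = (b - (w + z)) + z by rewrite opprD addrA subrK.
    by rewrite memvD.
  case: vf => [[s v_]|[s v_]|[j [s [t [ij v_]]]]]; rewrite {}v_ in bv.
  + have [z zr zE] := sub1 i s; exists (sgn (s (+) sg i) (eps i)).
    by split; [exists i; constructor 1; exists (s (+) sg i) | apply: dec bv zE zr].
  + have [z zr] := sub i s 2; rewrite !scaler_nat => zE;
    exists (sgn (s (+) sg i) (eps i *+ 2)).
    by split; [exists i; constructor 2; exists (s (+) sg i) | apply: dec bv zE zr].
  + have [z zr zE] := sub1 i s; have [y yr yE] := sub1 j t.
    exists (sgn (s (+) sg i) (eps i) + sgn (t (+) sg j) (eps j)); split.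
      by exists i; constructor 3; exists j, (s (+) sg i), (t (+) sg j).
    apply: dec bv _ (memvD zr yr); rewrite zE yE; exact: addrACA.
Qed.

End Frame.

(** * The radical parts of the roots *)

Section Isotropic.
Variables (K : realType) (F : vectType K) (I : {symmetric F}) (R : set F).
Hypothesis hR : root_system I R.
Hypothesis I_ge0 : forall x, 0 <= I x x.
Variables (l : nat) (N : K) (eps : 'I_l -> F).
Hypothesis fr : is_frame I R N eps.

Let N0 : 0 < N := frame_gt0 fr.
Let epsE := frame_orth fr.
Let root_reflE := root_reflE hR I_ge0.
Let root_opp := root_opp hR I_ge0.

Lemma root_flip i d v : R v -> I (eps i) v = d * N -> R (v - (2 * d) *: eps i).
Proof.
move=> Rv h; apply: root_reflE => //; first exact: (frame_short fr).
by rewrite epsE eqxx mul1r h mulrA.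
Qed.

Lemma root_swap i j d v : i != j -> R v -> I (eps i - eps j) v = d * N ->
  R (v - d *: (eps i - eps j)).
Proof.
move=> ij Rv h; apply: root_reflE => //; first exact: (frame_middle fr).
rewrite h !sformE !epsE !eqxx [j == i]eq_sym (negPf ij) mul1r mul0r; ring.
Qed.

(** The radical parts S, L, E of the roots that are short (eps_i), middle
    (eps_i - eps_j) or long (2eps_i) modulo the radical; membership is required for
    some index and is then shown to hold for all indices and signs. *)
Definition short_part : set F := [set z | z \in radical I /\ exists i, R (eps i + z)].
Definition middle_part : set F :=
  [set z | z \in radical I /\ exists i j, i != j /\ R (eps i - eps j + z)].
Definition long_part : set F :=
  [set z | z \in radical I /\ exists i, R (2 *: eps i + z)].

(** For a fixed radical part z, reflections in eps_i and eps_i - eps_j permute the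
    indices and change the signs. *)
Lemma root_line d i j s z : z \in radical I -> R (d *: eps i + z) ->
  R (sgn s (d *: eps j) + z).
Proof.
move=> zr Rz.
have {}Rz : R (d *: eps j + z).
  have [<-//|ij] := eqVneq i j.
  have -> : d *: eps j + z = (d *: eps i + z) - d *: (eps i - eps j) by vring.
  apply: root_swap => //;
    rewrite !sformE !(rad0r _ zr) !epsE eqxx [j == i]eq_sym (negPf ij) /=.
  by rewrite mulr1n; ring.
case: s => //=.
have -> : - (d *: eps j) + z = (d *: eps j + z) - (2 * d) *: eps j by vring.
by apply: root_flip; rewrite // !sformE (rad0r _ zr) epsE eqxx /= mulr1n; ring.
Qed.

Lemma root_plane_flip i j d d' z : i != j -> z \in radical I ->
  R (d *: eps i + d' *: eps j + z) -> R (- d *: eps i + d' *: eps j + z).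
Proof.
move=> ij zr Rz.
have -> : - d *: eps i + d' *: eps j + z =
  (d *: eps i + d' *: eps j + z) - (2 * d) *: eps i by vring.
apply: root_flip => //; rewrite !sformE !(rad0r _ zr) !epsE eqxx (negPf ij) /=.
by rewrite mulr1n; ring.
Qed.

Lemma root_plane_move i j k d d' z : i != j -> k != j -> z \in radical I ->
  R (d *: eps i + d' *: eps j + z) -> R (d *: eps k + d' *: eps j + z).
Proof.
move=> ij kj zr Rz; have [<-//|ik] := eqVneq i k.
have -> : d *: eps k + d' *: eps j + z =
  (d *: eps i + d' *: eps j + z) - d *: (eps i - eps k) by vring.
apply: root_swap => //; rewrite !sformE !(rad0r _ zr) !epsE eqxx.
by rewrite [k == i]eq_sym (negPf ij) (negPf ik) (negPf kj) /= mulr1n; ring.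
Qed.

Lemma short_partP i s z : short_part z -> R (sgn s (eps i) + z).
Proof.
by move=> [zr [j Rj]]; have := @root_line 1 j i s z zr; rewrite !scale1r; apply.
Qed.

Lemma long_partP i s z : long_part z -> R (sgn s (2 *: eps i) + z).
Proof. by move=> [zr [j Rj]]; apply: root_line Rj. Qed.

Lemma middle_partP i j s t z : i != j -> middle_part z ->
  R (sgn s (eps i) + sgn t (eps j) + z).
Proof.
move=> ij [zr [i' [j' [ij' Rz]]]].
have {Rz} : R ((1 : K) *: eps i' + (-1 : K) *: eps j' + z) by rewrite scale1r scaleN1r.
have C (p q : 'I_l) (d d' : K) : R (d *: eps p + d' *: eps q + z) -> R (d' *: eps q
  + d *: eps p + z).
  by rewrite (addrC (d *: _)).
have Fl p q (d : K) u : p != q -> R (d *: eps p + u *: eps q + z) ->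
    forall s : bool, R (((-1) ^+ s * d) *: eps p + u *: eps q + z).
  move=> pq h [|]; last by rewrite expr0 mul1r.
  by rewrite expr1 mulN1r; apply: root_plane_flip.
have M p q p' q' : p != q -> p' != q' -> p' != q ->
    R ((1 : K) *: eps p + (-1 : K) *: eps q + z) ->
    R ((1 : K) *: eps p' + (-1 : K) *: eps q' + z).
  move=> pq pq' p'q h; apply: (C); apply: (@root_plane_move q) => //.
  - by rewrite eq_sym.
  - by rewrite eq_sym.
  - by apply: (C); apply: (@root_plane_move p).
move=> Rz.
have {Rz} Rz : R ((1 : K) *: eps i + (-1 : K) *: eps j + z).
  have [ij''|] := eqVneq i j'; last by move=> h; apply: M Rz.
  apply: (M j' i') => //; first by rewrite eq_sym.
    by rewrite ij'' eq_sym.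
  have ji' : j' != i' by rewrite eq_sym.
  have := Fl _ _ _ _ ij' Rz true; rewrite expr1 mulN1r => /C h.
  by have := Fl _ _ _ _ ji' h true; rewrite expr1 mulN1r opprK.
have := Fl _ _ _ _ ij Rz s => /C h.
have ji : j != i by rewrite eq_sym.
have := Fl _ _ _ _ ji h (~~ t) => /C.
by rewrite !sgnZ mulr1 mulrN1 signrN opprK.
Qed.

Lemma short_part_rad z : short_part z -> z \in radical I. Proof. by case. Qed.
Lemma long_part_rad z : long_part z -> z \in radical I. Proof. by case. Qed.

Lemma shortW i s z : z \in radical I -> R (sgn s (eps i) + z) -> short_part z.
Proof.
move=> zr; rewrite sgnZ => /(root_line i s zr) h; split=> //; exists i.
by move: h; rewrite !sgnZ scalerA signr_sq scale1r.
Qed.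

Lemma longW i s z : z \in radical I -> R (sgn s (2 *: eps i) + z) -> long_part z.
Proof.
move=> zr; rewrite sgnZ scalerA => /(root_line i s zr) h; split=> //; exists i.
by move: h; rewrite !sgnZ !scalerA mulrA signr_sq mul1r.
Qed.

Lemma middleW i j s t z : i != j -> z \in radical I ->
  R (sgn s (eps i) + sgn t (eps j) + z) -> middle_part z.
Proof.
move=> ij zr; rewrite !sgnZ => h; split=> //; exists i, j; split=> //.
have sg (u v : bool) (p q : 'I_l) (d : K): p != q -> R ((-1) ^+ u *: eps p + d *:
  eps q + z) ->
    R ((-1) ^+ v *: eps p + d *: eps q + z).
  move=> pq h'; case: u v h' => [] [] h' //.
    by have := root_plane_flip pq zr h'; rewrite expr1 opprK.
  by have := root_plane_flip pq zr h'; rewrite expr0 expr1.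
have ji : j != i by rewrite eq_sym.
have := sg s false _ _ _ ij h; rewrite (addrC (_ *: eps i)) => h1.
have := sg t true _ _ _ ji h1.
by rewrite expr0 expr1 scale1r scaleN1r (addrC (- _)).
Qed.

Section Closure.
Hypothesis l0 : (0 < l)%N.
Let i0 : 'I_l := Ordinal l0.

Lemma short0 : short_part 0.
Proof. by split; [exact: mem0v|exists i0; rewrite addr0; apply: (frame_short fr)]. Qed.

Lemma long0 : long_part 0.
Proof. by split; [exact: mem0v|exists i0; rewrite addr0; apply: (frame_long fr)]. Qed.

Lemma middle0 : (1 < l)%N -> middle_part 0.
Proof.
move=> l1; split; [exact: mem0v|exists i0, (Ordinal l1); split=> //].
by rewrite addr0; apply: (frame_middle fr).
Qed.

(** Closure of the radical parts: each lemma below is one reflection between roots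
    of the two classes in its name. *)
Lemma shortN z : short_part z -> short_part (- z).
Proof.
move=> h; have := root_opp (short_partP i0 false h); rewrite opprD => h'.
by apply: (@shortW i0 true) => //; rewrite memvN short_part_rad.
Qed.

Lemma longN z : long_part z -> long_part (- z).
Proof.
move=> h; have := root_opp (long_partP i0 false h); rewrite opprD => h'.
by apply: (@longW i0 true) => //; rewrite memvN long_part_rad.
Qed.

Lemma middleN z : middle_part z -> middle_part (- z).
Proof.
move=> h; have [zr [i [j [ij _]]]] := h.
have := root_opp (middle_partP false false ij h); rewrite !opprD => h'.
by apply: (@middleW i j true true) => //; rewrite memvN.
Qed.

Ltac radical_form hx hy := rewrite ?sgnZ !sformE
  ?(rad0l _ hx) ?(rad0r _ hx) ?(rad0l _ hy) ?(rad0r _ hy) !epsE ?eqxx.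

Lemma short_short x y : short_part x -> short_part y -> short_part (y - 2 *: x).
Proof.
move=> hx hy; have xr := short_part_rad hx; have yr := short_part_rad hy.
apply: (@shortW i0 true); first by rewrite memvB ?memvZ.
have -> : sgn true (eps i0) + (y - 2 *: x) =
  (sgn false (eps i0) + y) - 2 *: (sgn false (eps i0) + x) by vring.
apply: root_reflE; try exact: short_partP.
by radical_form xr yr; rewrite /= !mulr1n; ring.
Qed.

Lemma short_middle x y : short_part x -> middle_part y -> short_part (x - y).
Proof.
move=> hx hy; have xr := short_part_rad hx; have [yr [i [j [ij _]]]] := hy.
apply: (@shortW j false); first by rewrite memvB.
have -> : sgn false (eps j) + (x - y) =
  (sgn false (eps i) + x) - 1 *: (sgn false (eps i) + sgn true (eps j) + y) by vring.
apply: root_reflE; [exact: middle_partP | exact: short_partP |].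
by radical_form xr yr; rewrite ![j == i]eq_sym (negPf ij) /= !mulr1n; ring.
Qed.

Lemma middle_short x y : middle_part x -> short_part y -> middle_part (x - 2 *: y).
Proof.
move=> hx hy; have [xr [i [j [ij _]]]] := hx; have yr := short_part_rad hy.
apply: (@middleW i j true false); rewrite ?memvB ?memvZ //.
have -> : sgn true (eps i) + sgn false (eps j) + (x - 2 *: y) =
  (sgn false (eps i) + sgn false (eps j) + x) - 2 *: (sgn false (eps i) + y) by vring.
apply: root_reflE; [exact: short_partP | exact: middle_partP |].
by radical_form xr yr; rewrite ?[j == i]eq_sym (negPf ij) /= !mulr1n; ring.
Qed.

Lemma middle_middle x y : (2 < l)%N -> middle_part x -> middle_part y ->
  middle_part (x + y).
Proof.
move=> l2 hx hy; have [xr _] := hx; have [yr _] := hy.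
pose i1 : 'I_l := Ordinal (ltnW l2); pose i2 : 'I_l := Ordinal l2.
apply: (@middleW i0 i2 false true); rewrite ?memvD //.
have -> : sgn false (eps i0) + sgn true (eps i2) + (x + y) =
  (sgn false (eps i1) + sgn true (eps i2) + y)
    - (-1) *: (sgn false (eps i0) + sgn true (eps i1) + x) by vring.
apply: root_reflE; [exact: middle_partP | exact: middle_partP |].
by radical_form xr yr; rewrite /= !mulr1n; ring.
Qed.

Lemma long_middle x y : long_part x -> middle_part y -> long_part (x - 2 *: y).
Proof.
move=> hx hy; have xr := long_part_rad hx; have [yr [i [j [ij _]]]] := hy.
apply: (@longW j false); first by rewrite memvB ?memvZ.
have -> : sgn false (2 *: eps j) + (x - 2 *: y) =
  (sgn false (2 *: eps i) + x) - 2 *: (sgn false (eps i) + sgn true (eps j) + y) by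
    vring.
apply: root_reflE; [exact: middle_partP | exact: long_partP |].
by radical_form xr yr; rewrite ![j == i]eq_sym (negPf ij) /= !mulr1n; ring.
Qed.

Lemma middle_long x y : middle_part x -> long_part y -> middle_part (x - y).
Proof.
move=> hx hy; have [xr [i [j [ij _]]]] := hx; have yr := long_part_rad hy.
apply: (@middleW i j true false); rewrite ?memvB //.
have -> : sgn true (eps i) + sgn false (eps j) + (x - y) =
  (sgn false (eps i) + sgn false (eps j) + x) - 1 *: (sgn false (2 *: eps i) + y)
    by vring.
apply: root_reflE; [exact: long_partP | exact: middle_partP |].
by radical_form xr yr; rewrite ?[j == i]eq_sym (negPf ij) /= !mulr1n; ring.
Qed.

Lemma short_long x y : short_part x -> long_part y -> short_part (x - y).
Proof.
move=> hx hy; have xr := short_part_rad hx; have yr := long_part_rad hy.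
apply: (@shortW i0 true); first by rewrite memvB.
have -> : sgn true (eps i0) + (x - y) =
  (sgn false (eps i0) + x) - 1 *: (sgn false (2 *: eps i0) + y) by vring.
apply: root_reflE; [exact: long_partP | exact: short_partP |].
by radical_form xr yr; rewrite /= !mulr1n; ring.
Qed.

Lemma long_short x y : long_part x -> short_part y -> long_part (x - 4 *: y).
Proof.
move=> hx hy; have xr := long_part_rad hx; have yr := short_part_rad hy.
apply: (@longW i0 true); first by rewrite memvB ?memvZ.
have -> : sgn true (2 *: eps i0) + (x - 4 *: y) =
  (sgn false (2 *: eps i0) + x) - 4 *: (sgn false (eps i0) + y) by vring.
apply: root_reflE; [exact: short_partP | exact: long_partP |].
by radical_form xr yr; rewrite /= !mulr1n; ring.
Qed.

Lemma long_long x y : long_part x -> long_part y -> long_part (x - 2 *: y).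
Proof.
move=> hx hy; have xr := long_part_rad hx; have yr := long_part_rad hy.
apply: (@longW i0 true); first by rewrite memvB ?memvZ.
have -> : sgn true (2 *: eps i0) + (x - 2 *: y) =
  (sgn false (2 *: eps i0) + x) - 2 *: (sgn false (2 *: eps i0) + y) by vring.
apply: root_reflE; [exact: long_partP | exact: long_partP |].
by radical_form xr yr; rewrite /= !mulr1n; ring.
Qed.

End Closure.

Lemma roots_decomposition : R = roots_over eps short_part middle_part long_part.
Proof.
apply/seteqP; split=> [b Rb|b].
  have [v [[i vf] zr]] := frame_form fr Rb.
  have bE : b = v + (b - v) by rewrite addrC subrK.
  move: zr bE; move: (b - v) => z zr bE; rewrite bE in Rb *.
  case: vf => [[s v_]|[s v_]|[j [s [t [ij v_]]]]]; rewrite {}v_ in bE Rb *.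
  - left; left; exists (sgn s (eps i)); first by exists i, s.
    by exists z => //; apply: shortW Rb.
  - right; exists (sgn s (eps i *+ 2)); first by exists i, s.
    by exists z => //; rewrite -scaler_nat in Rb; apply: longW Rb.
  - left; right; exists (sgn s (eps i) + sgn t (eps j)).
      have [ilj|jli] := ltnP i j; first by exists i, j, s, t.
      exists j, i, t, s; rewrite addrC; split=> //.
      by rewrite ltn_neqAle jli andbT eq_sym.
    by exists z => //; apply: middleW ij zr Rb.
move=> [[|]|] [v vB [z zP <-]].
- by case: vB => i [s ->]; apply: short_partP.
- case: vB => i [j [s [t [ij ->]]]]; apply: middle_partP => //.
  by apply/eqP => e; rewrite e ltnn in ij.
- by case: vB => i [s ->]; rewrite -scaler_nat; apply: long_partP.
Qed.

End Isotropic.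

Lemma int_span_coord (K : realType) (F : vectType K) n (e : n.-tuple F) x :
  free e -> int_span e x -> forall i, exists m : int, coord e i x = m%:~R.
Proof.
move=> fe [c ->] i; exists (c i).
under eq_bigr do rewrite -scaler_int.
by rewrite coord_sum_free.
Qed.

(** * The lattice of radical parts *)

Section Lattice.
Variables (K : realType) (F : vectType K) (I : {symmetric F}) (R : set F).
Hypothesis hR : root_system I R.
Hypothesis I_ge0 : forall x, 0 <= I x x.
Variables (l : nat) (N : K) (eps : 'I_l -> F).
Hypothesis fr : is_frame I R N eps.
Hypothesis l0 : (0 < l)%N.
Hypothesis dF : \dim {:F} = (l + 2)%N.
Hypothesis dr : \dim (radical I) = 2%N.

Let Lam := generated_subgroup (short_part I R eps).
Let Q := generated_subgroup R.

Lemma short_group_radical x : Lam x -> x \in radical I.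
Proof.
apply: (@generated_subgroup_min _ _ [set x | x \in radical I]); last by move=> z [].
by split=> /= [|y z]; [exact: mem0v | exact: memvB].
Qed.

Lemma short_group_lattice : Lam `<=` Q.
Proof.
apply: generated_subgroup_min; first exact: generated_subgroupP.
move=> z zs; have i0 := Ordinal l0.
have -> : z = (sgn false (eps i0) + z) - eps i0 by rewrite /= addrC addKr.
apply: (subgroupB (generated_subgroupP R)); apply: sub_generated_subgroup.
  exact: (short_partP hR I_ge0 fr).
exact: (frame_short fr).
Qed.

(** The middle and long radical parts lie in the group Lam generated by the short ones:
    short_middle and short_long apply to the short radical part 0. *)
Lemma roots_sub_short_group (H : set F) : is_subgroup H -> (forall i, H (eps i)) ->
  Lam `<=` H -> R `<=` H.
Proof.
move=> sH He LH.
have sg s x : H x -> H (sgn s x) by case: s => //=; apply: subgroupN.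
have mL z : middle_part I R eps z -> Lam z.
  move=> /(short_middle hR I_ge0 fr (short0 fr l0)); rewrite sub0r => h.
  by rewrite -[z]opprK; apply: (subgroupN (generated_subgroupP _));
     apply: sub_generated_subgroup.
have lL z : long_part I R eps z -> Lam z.
  move=> /(short_long hR I_ge0 fr l0 (short0 fr l0)); rewrite sub0r => h.
  by rewrite -[z]opprK; apply: (subgroupN (generated_subgroupP _));
     apply: sub_generated_subgroup.
rewrite (roots_decomposition hR I_ge0 fr) => x.
move=> [[|]|] [v vB [z zP <-]]; apply: (subgroupD sH).
- by case: vB => i [s ->]; apply: sg.
- by apply: LH; apply: sub_generated_subgroup.
- by case: vB => i [j [s [t [_ ->]]]]; apply: (subgroupD sH); apply: sg.
- by apply: LH; apply: mL.
- by case: vB => i [s ->]; apply: sg; apply: (subgroupMn sH).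
- by apply: LH; apply: lL.
Qed.

Lemma lattice_radical_short_group x : Q x -> x \in radical I -> Lam x.
Proof.
pose H := [set x | exists c : 'I_l -> int, exists2 z, Lam z & x = \sum_i eps i *~ c
  i + z].
have sL := generated_subgroupP (short_part I R eps).
have sH : is_subgroup H.
  split; first by exists (fun=> 0), 0; [exact: (subgroup0 sL) | rewrite big1 ?addr0].
  move=> _ _ [c [z zL ->]] [c' [z' zL' ->]].
  exists (fun i => c i - c' i), (z - z'); first exact: (subgroupB sL).
  rewrite opprD addrACA -sumrB; congr (_ + _); apply: eq_bigr => i _.
  by rewrite mulrzBr.
have QH : Q `<=` H.
  apply: generated_subgroup_min => //; apply: roots_sub_short_group => //.
    move=> i; exists (fun j => (j == i)%:Z), 0; first exact: (subgroup0 sL).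
    rewrite (bigD1 i) //= eqxx big1 ?addr0 ?mulr1z // => j /negPf ->.
    by rewrite mulr0z.
  move=> z zL; exists (fun=> 0), z => //.
  by rewrite big1 ?add0r.
move=> /QH [c [z zL ->]] xr; rewrite big1 ?add0r // => i _.
have := rad0l (eps i) xr;
  rewrite sformDl (rad0l _ (short_group_radical zL)) addr0 sform_suml.
rewrite (bigD1 i) //= big1 => [|j ji].
  rewrite -scaler_int sformZl (frame_orth fr) eqxx mul1r addr0 => /eqP.
  by rewrite mulf_eq0 (gt_eqF (frame_gt0 fr)) orbF => /eqP ->; rewrite scale0r.
by rewrite -scaler_int sformZl (frame_orth fr) (negPf ji) mul0r mulr0.
Qed.

Variable G : {vspace F}.
Hypothesis Gr : (G <= radical I)%VS.
Hypothesis dG : \dim G = 1%N.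
Hypothesis GQ : is_lattice ([set x | x \in G] `&` Q) 1.

Lemma short_group_not_in_marking : exists2 x, Lam x & x \notin G.
Proof.
apply: contrapT => nx.
have LG x : Lam x -> x \in G.
  by move=> Lx; apply: contrapT => /negP xG; apply: nx; exists x.
pose E := [tuple eps i | i < l].
have : (<<E>> + G)%VS = fullv.
  apply: (root_spanning hR).
  apply: (@roots_sub_short_group [set x | x \in (<<E>> + G)%VS]).
  - by split=> /= [|x y]; [exact: mem0v | exact: memvB].
  - move=> i /=; rewrite -[eps i]addr0 memv_add ?mem0v //.
    by have := mem_tnth i E; rewrite tnth_mktuple => /memv_span.
  - by move=> z /LG zG /=; rewrite -[z]add0r memv_add ?mem0v.
move=> /(congr1 (fun U => \dim U)); rewrite dF => d.
have := dimv_add_leqif <<E>>%VS G; rewrite d dG => -[h _].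
have := dim_span E; rewrite size_tuple; lia.
Qed.

(** The functional f_j, a minor of the integral coordinates of a and of its argument
    in a basis of the root lattice, is integral on the group of radical parts, and on
    the radical its kernel is G; b is an element at which it takes its least
    positive value d. *)
Lemma lattice_basis : exists a b, [/\ G = <[a]>%VS, Lam a, Lam b, b \notin G
  & forall x, Lam x -> exists m n : int, x = a *~ m + b *~ n].
Proof.
have sL := generated_subgroupP (short_part I R eps).
have [g fg gE] := GQ.
pose a := g`_0.
have a0 : a != 0.
  apply: (free_not0 fg); rewrite /a -(tnth_nth 0 g ord0); exact: mem_tnth.
have [aG aQ] : a \in G /\ Q a.
  have : int_span g a.
    by exists (fun=> 1); rewrite big_ord1 mulr1z.
  by rewrite -gE => -[].
have GE : G = <[a]>%VS.
  apply/eqP; rewrite eq_sym eqEdim dG dim_vline a0 andbT.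
  by apply/subvP => x /vlineP [c ->]; rewrite memvZ.
have aL : Lam a by apply: lattice_radical_short_group => //; apply: (subvP Gr).
have GL x : x \in G -> Lam x -> exists m : int, x = a *~ m.
  move=> xG /short_group_lattice xQ; have : int_span g x by rewrite -gE.
  by case=> c ->; exists (c ord0); rewrite big_ord1.
have [y yL yG] := short_group_not_in_marking.
have [e fe eE] := root_lattice hR.
have eb : basis_of fullv e by rewrite basisEfree fe subvf size_tuple leqnn.
have xE x := coord_basis eb (memvf x).
have [i ai] : exists i, coord e i a != 0.
  apply: contrapT => nx; case/eqP: a0; rewrite (xE a) big1 // => i _.
  suff -> : coord e i a = 0 by rewrite scale0r.
  by apply/eqP; apply: contrapT => /negP h; apply: nx; exists i.
pose f j x := coord e i a * coord e j x - coord e j a * coord e i x.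
have [j fy] : exists j, f j y != 0.
  apply: contrapT => nx; case/negP: yG.
  have -> : y = (coord e i y / coord e i a) *: a.
    rewrite (xE y) (xE a) scaler_sumr; apply: eq_bigr => j _;
      rewrite -xE -[in coord e i (\sum_k _)]xE scalerA.
    congr (_ *: _); apply: (mulfI ai).
    have : f j y = 0 by apply/eqP; apply: contrapT => /negP h; apply: nx; exists j.
    by move/eqP; rewrite subr_eq0 => /eqP ->; field.
  by rewrite memvZ.
have fD x z : f j (x - z) = f j x - f j z by rewrite /f !linearB /=; ring.
have fA x z : f j (x + z) = f j x + f j z by rewrite /f !linearD /=; ring.
have fZ c x : f j (c *: x) = c * f j x by rewrite /f !linearZ /=; ring.
have fz m x : f j (x *~ m) = m%:~R * f j x by rewrite -scaler_int fZ.
have fa : f j a = 0 by rewrite /f; ring.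
have fG x : x \in G -> f j x = 0.
  by rewrite GE => /vlineP [c ->]; rewrite fZ fa mulr0.
have rE : radical I = (G + <[y]>)%VS.
  apply/eqP; rewrite eq_sym eqEdim dr subv_add Gr /=.
  have y0 : y != 0 by apply: contraNneq yG => ->; exact: mem0v.
  have -> : (<[y]> <= radical I)%VS.
    by apply/subvP => x /vlineP [c ->]; rewrite memvZ // short_group_radical.
  rewrite dimv_disjoint_sum ?dG ?dim_vline ?y0 //.
  apply/eqP; rewrite -subv0; apply/subvP => x; rewrite memv_cap => /andP[xG].
  case/vlineP => c xc; move: (fG _ xG); rewrite xc fZ => /eqP.
  by rewrite mulf_eq0 (negPf fy) orbF => /eqP ->; rewrite scale0r mem0v.
have f0 x : x \in radical I -> f j x = 0 -> x \in G.
  rewrite rE => /memv_addP [u uG [v /vlineP [c ->] ->]].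
  rewrite fA fZ (fG u uG) add0r => /eqP.
  by rewrite mulf_eq0 (negPf fy) orbF => /eqP ->; rewrite scale0r addr0.
have fint x : Lam x -> exists m : int, f j x = m%:~R.
  move=> /short_group_lattice; rewrite /Q eE => xs.
  have as_ : int_span e a by rewrite -eE.
  have [m1 e1] := int_span_coord fe xs i.
  have [m2 e2] := int_span_coord fe xs j.
  have [m3 e3] := int_span_coord fe as_ i.
  have [m4 e4] := int_span_coord fe as_ j.
  by exists (m3 * m2 - m4 * m1); rewrite /f e1 e2 e3 e4 intrB !intrM.
pose P n := (0 < n)%N && `[< exists2 x, Lam x & f j x = n%:R >].
have exP : exists n, P n.
  have [m mE] := fint y yL; exists `|m|%N; apply/andP; split.
    by rewrite absz_gt0; apply: contra_neq fy => m0; rewrite mE m0.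
  apply/asboolP; case: m mE => m mE; first by exists y.
  exists (- y); first exact: (subgroupN sL).
  by rewrite -scaleN1r fZ mE mulN1r NegzE mulrNz opprK.
case: (ex_minnP exP) => d /andP[d0 /asboolP [b bL bE]] dmin.
exists a, b; split=> //.
  by apply/negP => /fG; rewrite bE => /eqP; rewrite pnatr_eq0 gtn_eqF.
move=> x xL; have [m mE] := fint x xL.
pose q := (m %/ d)%Z; pose r := `|(m %% d)%Z|%N.
have rE' : (r%:Z = m %% d)%Z by rewrite /r gez0_abs // modz_ge0 // eqz_nat -lt0n.
have zL : Lam (x - b *~ q) by apply: (subgroupB sL) => //; apply: (subgroupMz sL).
have fr0 : f j (x - b *~ q) = r%:R.
  rewrite fD fz mE bE -[d%:R]/(d%:Z%:~R) -intrM -intrB -[r%:R]/(r%:Z%:~R) rE'.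
  by congr (_%:~R); rewrite {1}(divz_eq m d); ring.
have r0 : r = 0%N.
  apply/eqP; rewrite -leqn0 leqNgt; apply/negP => rp.
  have : P r by rewrite /P rp; apply/asboolP; exists (x - b *~ q).
  move/dmin; have : (m %% d < d)%Z by rewrite ltz_pmod.
  by rewrite -rE' ltz_nat ltnNge => /negPf ->.
have zG : x - b *~ q \in G by apply: f0; [exact: short_group_radical | rewrite fr0 r0].
have [n nE] := GL _ zG zL.
by exists n, q; rewrite -nE subrK.
Qed.

End Lattice.

(** * Coordinates: triples of subsets of Z^2 *)

(** The group of periods of a subset of an abelian group *)
Definition periods (V : zmodType) (X : set V) : set V :=
  [set x | forall y, X y -> X (y + x) /\ X (y - x)].

Section Stab.
Variable V : zmodType.
Implicit Types X A : set V.

Lemma periods_subgroup X : is_subgroup (periods X).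
Proof.
split=> [y Xy|x z hx hz y Xy]; first by rewrite addr0 subr0.
have [hp hm] := hx y Xy; split; first by rewrite addrA; case: (hz _ hp).
by rewrite opprB addrA addrAC; case: (hz _ hm).
Qed.

Lemma mulrn_subgroup A n : is_subgroup A -> is_subgroup [set x | A (x *+ n)].
Proof.
move=> sA; split=> [|x y Ax Ay] /=; first by rewrite mul0rn; exact: subgroup0.
by rewrite mulrnBl; apply: subgroupB.
Qed.
End Stab.

(** The closure properties of the triple of a non-reduced root system. The last two
    fields state that L is a group unless l = 2, and that for l = 1 it is generated by
    E and the even points. *)
Record compatible (l : nat) (S L E : set (int * int)) : Prop := Compatible {
  compat_S0 : S 0;
  compat_L0 : L 0;
  compat_E0 : E 0;
  compat_gen : forall H, is_subgroup H -> S `<=` H -> forall x, H x;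
  compat_S2 : forall x, periods S (x *+ 2);
  compat_L2 : forall x, periods L (x *+ 2);
  compat_E4 : forall x, periods E (x *+ 4);
  compat_SL : L `<=` periods S;
  compat_LE : E `<=` periods L;
  compat_EL : forall x, L x -> periods E (x *+ 2);
  compat_LL : l <> 2%N -> L `<=` periods L;
  compat_one : l = 1%N -> forall H, is_subgroup H -> E `<=` H ->
    (forall x, H (x *+ 2)) -> L `<=` H
}.

(** The points m a + n b, for (m, n) in X *)
Definition pts (V : zmodType) (a b : V) (X : set (int * int)) : set V :=
  [set a *~ x.1 + b *~ x.2 | x in X].

(** (R, G) has the triple (S, L, E) in some frame: eps, a and b span F, a spans G, and
    R is the union of B_s + S, B_m + L and B_l + E. The vectors are not required to be
    free; they are as soon as F has dimension l + 2. *)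
Definition framed (K : realType) (F : vectType K) (R : set F) (G : {vspace F})
    (l : nat) (S L E : set (int * int)) : Prop :=
  exists (eps : 'I_l -> F) (a b : F),
    [/\ forall U : {vspace F}, (forall i, eps i \in U) -> a \in U -> b \in U ->
          U = fullv,
        G = <[a]>%VS
      & R = roots_over eps (pts a b S) (pts a b L) (pts a b E)].

(** B_m is empty if l <= 1. *)
Lemma roots_over_ext (V : zmodType) l (eps : 'I_l -> V) S L L' E :
  ((1 < l)%N -> L = L') -> roots_over eps S L E = roots_over eps S L' E.
Proof.
case: l eps => [|[|l]] eps; last by move=> ->.
  by move=> _; congr (_ `|` _ `|` _); apply/seteqP; split=> x [v [[]]].
move=> _; congr (_ `|` _ `|` _); apply/seteqP; split=> x [v [i [j [s [t []]]]]];
  by rewrite !ord1.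
Qed.

Section Coordinates.
Variables (K : realType) (F : vectType K) (I : {symmetric F}) (R : set F).
Variables (l : nat) (G : {vspace F}).

Lemma framed_compatible_exists : (1 <= l)%N -> marked_elliptic_root_system l I R G ->
  ~ reduced R -> exists S L E, framed R G l S L E /\ compatible l S L E.
Proof.
move=> l0 [[hR hs] Gr dG GQ] nR.
have I_ge0 := form_ge0 hs; have I_eq0 := isotropic_radical hs.
have dF := dim_signature hs; have dr := dim_radical hs.
have [N [eps fr]] := frame_exists hR I_ge0 I_eq0 dF dr nR.
have [a [b [GE aL bL bG LE]]] := lattice_basis hR I_ge0 fr l0 dF dr Gr dG GQ.
set sp := short_part I R eps in aL bL LE.
pose mp := middle_part I R eps; pose lp := long_part I R eps.
have sL := generated_subgroupP sp.
pose pt (p : int * int) := a *~ p.1 + b *~ p.2.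
have ptB p q : pt (p - q) = pt p - pt q.
  by rewrite /pt /= !mulrzBr opprD addrACA.
have pt0 : pt 0 = 0 by rewrite /pt !mulr0z addr0.
have ptN p : pt (- p) = - pt p by have := ptB 0 p; rewrite pt0 !sub0r.
have ptD p q : pt (p + q) = pt p + pt q by have := ptB p (- q); rewrite ptN !opprK.
have ptM p n : pt (p *+ n) = n%:R *: pt p.
  rewrite scaler_nat; elim: n => [|n IHn]; first by rewrite !mulr0n.
  by rewrite !mulrS ptD IHn.
(* a and b are linearly independent *)
have pt_eq0 p : pt p = 0 -> p = 0.
  move=> h; have a0 : a != 0.
    by apply: contra_eq_neq dG => a0; rewrite GE a0 dim_vline eqxx.
  have p2 : p.2 = 0.
    apply/eqP; apply: contraNT bG => p2; rewrite GE.
    have -> : b = (- p.1%:~R / p.2%:~R) *: a.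
      have p2' : p.2%:~R != 0 :> K by rewrite intr_eq0.
      apply: (scalerI p2'); rewrite scalerA mulrC divfK //.
      move/eqP: h; rewrite /pt -!scaler_int addrC addr_eq0 => /eqP ->.
      by rewrite scaleNr.
    by rewrite memvZ // memv_line.
  move/eqP: h; rewrite /pt p2 mulr0z addr0 -scaler_int scaler_eq0 (negPf a0) orbF.
  by rewrite intr_eq0 => /eqP p1; case: p p1 p2 => x y /= -> ->.
have ptL p : generated_subgroup sp (pt p).
  by apply: (subgroupD sL); apply: (subgroupMz sL).
pose S := [set p | sp (pt p)]; pose M := [set p | mp (pt p)];
  pose E := [set p | lp (pt p)].
have LC X : X `<=` generated_subgroup sp -> X = pts a b [set p | X (pt p)].
  move=> XL; apply/seteqP; split=> [x Xx|x [p /= Xp <-] //].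
  have [m [n xE]] := LE x (XL _ Xx).
  by exists (m, n) => //=; rewrite /pt /= -xE.
have sps : sp `<=` generated_subgroup sp by exact: sub_generated_subgroup.
have mps : mp `<=` generated_subgroup sp.
  move=> z /(short_middle hR I_ge0 fr (short0 fr l0)); rewrite sub0r => h.
  by rewrite -[z]opprK; apply: (subgroupN sL); apply: sps.
have lps : lp `<=` generated_subgroup sp.
  move=> z /(short_long hR I_ge0 fr l0 (short0 fr l0)); rewrite sub0r => h.
  by rewrite -[z]opprK; apply: (subgroupN sL); apply: sps.
have stabP (X Y : set F) n : (forall x, Y x -> Y (- x)) ->
    (forall x y, X x -> Y y -> X (x - n%:R *: y)) ->
    forall p, Y (pt p) -> periods [set p | X (pt p)] (p *+ n).
  move=> YN XY p Yp q /= Xq; rewrite ptD ptB ptM; split; last exact: XY.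
  by rewrite -[pt p]opprK scalerN; apply: XY => //; apply: YN.
have stab1 (X Y : set F) : (forall x, Y x -> Y (- x)) ->
    (forall x y, X x -> Y y -> X (x - y)) ->
    forall p, Y (pt p) -> periods [set p | X (pt p)] p.
  move=> YN XY p Yp; rewrite -[p]mulr1n; apply: (stabP X Y) => // x y Xx Yy.
  by rewrite scale1r; apply: XY.
have spN := shortN hR I_ge0 fr l0.
have mpN := middleN hR I_ge0 fr.
have lpN := longN hR I_ge0 fr l0.
have gen H : is_subgroup H -> S `<=` H -> forall x, H x.
  move=> sH SH x.
  have : [set y | exists2 p, H p & y = pt p] (pt x).
    apply: (@generated_subgroup_min _ sp) (ptL x).
      split=> [|_ _ [p Hp ->] [q Hq ->]]; first by exists 0; [exact: subgroup0|].
      by exists (p - q); [exact: subgroupB | rewrite ptB].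
    move=> z zs; have [m [n zE]] := LE z (sps _ zs).
    by exists (m, n) => //; apply: SH; rewrite /S /= /pt /= -zE.
  case=> p Hp pE; suff -> : x = p by [].
  by apply/eqP; rewrite -subr_eq0; apply/eqP/pt_eq0; rewrite ptB pE subrr.
have S2 x : periods S (x *+ 2).
  apply: (gen [set x | periods S (x *+ 2)]);
    first exact/mulrn_subgroup/periods_subgroup.
  move=> p Sp; apply: (stabP sp sp) => // u v su sv.
  exact: (short_short hR I_ge0 fr l0).
have E4 x : periods E (x *+ 4).
  apply: (gen [set x | periods E (x *+ 4)]);
    first exact/mulrn_subgroup/periods_subgroup.
  move=> p Sp; apply: (stabP lp sp) => // u v su sv.
  exact: (long_short hR I_ge0 fr l0).
have SE : E `<=` periods S.
  by apply: (stab1 sp lp) => // u v su sv; exact: (short_long hR I_ge0 fr l0).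
have EE x : E x -> periods E (x *+ 2).
  by apply: (stabP lp lp) => // u v su sv; exact: (long_long hR I_ge0 fr l0).
have S0 : S 0 by rewrite /S /= pt0; exact: (short0 fr l0).
have E0 : E 0 by rewrite /E /= pt0; exact: (long0 fr l0).
have base (U : {vspace F}) : (forall i, eps i \in U) -> a \in U -> b \in U -> U = fullv.
  move=> eU aU bU; apply: (root_spanning hR);
    apply: (roots_sub_short_group hR I_ge0 fr l0 (H := [set x | x \in U])) => //.
    by split=> /= [|x y]; [exact: mem0v | exact: memvB].
  by move=> z /LE [m [n ->]] /=; rewrite -!scaler_int memvD // memvZ.
(* For l = 1 there are no middle roots and L is free to choose. *)
pose L := if l == 1%N then generated_subgroup (E `|` [set x *+ 2 | x in setT]) else M.
exists S, L, E; split.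
  exists eps, a, b; split=> //.
  rewrite {1}(roots_decomposition hR I_ge0 fr) -/sp -/mp -/lp.
  rewrite {1}(LC sp) // {1}(LC lp) //.
  apply: roots_over_ext => l1; rewrite /L; case: eqP l1 => [->//|_] _.
  exact: LC.
have [l1|l1] := eqVneq l 1%N.
  have LG : L = generated_subgroup (E `|` [set x *+ 2 | x in setT]) by rewrite /L
    l1 eqxx.
  have LsG : is_subgroup L by rewrite LG; exact: generated_subgroupP.
  have Lmin H : is_subgroup H -> E `<=` H -> (forall x, H (x *+ 2)) -> L `<=` H.
    move=> sH EH H2; rewrite LG;
      apply: generated_subgroup_min => // x [/EH//|[y _ <-]//].
  have EL : E `<=` L by move=> x Ex; rewrite LG; apply: sub_generated_subgroup; left.
  have L2 x : L (x *+ 2) by rewrite LG; apply: sub_generated_subgroup; right; exists x.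
  have LL : L `<=` periods L.
    by move=> x Lx y Ly; split; [exact: subgroupD | exact: subgroupB].
  split=> //.
  - exact: (subgroup0 LsG).
  - by move=> x; apply: LL.
  - by apply: Lmin => //; apply: periods_subgroup.
  - by move=> x /EL /LL.
  - apply: (Lmin [set x | periods E (x *+ 2)]) => //;
    first exact/mulrn_subgroup/periods_subgroup.
    by move=> x /=; rewrite -mulrnA; exact: E4.
have LM : L = M by rewrite /L (negPf l1).
have l2 : (1 < l)%N by lia.
rewrite LM; split=> //.
- by rewrite /M /= pt0; exact: (middle0 fr l0).
- move=> x; apply: (gen [set x | periods M (x *+ 2)]);
  first exact/mulrn_subgroup/periods_subgroup.
  move=> p Sp; apply: (stabP mp sp) => // u v su sv.
  exact: (middle_short hR I_ge0 fr).
- by apply: (stab1 sp mp) => // u v su sv; exact: (short_middle hR I_ge0 fr).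
- by apply: (stab1 mp lp) => // u v su sv; exact: (middle_long hR I_ge0 fr).
- by apply: (stabP lp mp) => // u v su sv; exact: (long_middle hR I_ge0 fr).
- move=> ln2; apply: (stab1 mp mp) => // u v su sv.
  by apply: (middle_middle hR I_ge0 fr l0); [lia| |exact: mpN].
- by move=> l1'; rewrite l1' in l1.
Qed.

End Coordinates.

(** * Changes of frame *)

Section Moves.
Variables (K : realType) (F : vectType K) (R : set F) (G : {vspace F}) (l : nat).
Implicit Types S L E X : set (int * int).

(** The effect on coordinates of replacing b by b + k a *)
Definition shear (k : int) X : set (int * int) := [set x | X (x.1 + k * x.2, x.2)].

Lemma framed_shear k S L E : framed R G l S L E ->
  framed R G l (shear k S) (shear k L) (shear k E).
Proof.
move=> [eps [a [b [gen GE RE]]]]; exists eps, a, (b + a *~ k); split=> //.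
  move=> U eU aU bU; apply: gen => //.
  by rewrite -(addrK (a *~ k) b) memvB // -scaler_int memvZ.
have ptsE X : pts a (b + a *~ k) (shear k X) = pts a b X.
  apply/seteqP; split=> [_ [[m n] /= Xx <-]|_ [[m n] /= Xx <-]].
    exists (m + k * n, n) => //=.
    vring.
  exists (m - k * n, n) => /=; first by rewrite /shear /= subrK.
  vring.
by rewrite !ptsE.
Qed.

Lemma roots_over_shift (eps : 'I_l -> F) (a b : F) (t : 'I_l -> int * int) S L E S'
  L' E' :
  (forall i s x, S x -> S' (x + sgn s (t i))) ->
  (forall (i j : 'I_l) s u x, (i < j)%N -> L x -> L' (x + sgn s (t i) + sgn u (t j))) ->
  (forall i s x, E x -> E' (x + sgn s (t i *+ 2))) ->
  roots_over eps (pts a b S) (pts a b L) (pts a b E) `<=`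
  roots_over (fun i => eps i - (a *~ (t i).1 + b *~ (t i).2))
    (pts a b S') (pts a b L') (pts a b E').
Proof.
pose pt (x : int * int) := a *~ x.1 + b *~ x.2.
have ptD x y : pt (x + y) = pt x + pt y by rewrite /pt /= !mulrzDr addrACA.
have ptS s x : pt (sgn s x) = sgn s (pt x).
  by case: s => //=; rewrite /pt /= !mulrNz -opprD.
have pt2 x : pt (x *+ 2) = pt x *+ 2 by rewrite !mulr2n ptD.
move=> hS hL hE _ [[|]|] [v vB [_ [x xX <-] <-]]; rewrite -/(pt x).
- case: vB => i [s ->]; left; left.
  exists (sgn s (eps i - pt (t i))); first by exists i, s.
  exists (pt (x + sgn s (t i))); first by exists (x + sgn s (t i)) => //; exact: hS.
  rewrite ptD ptS; vring.
- case: vB => i [j [s [u [ij ->]]]]; left; right.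
  exists (sgn s (eps i - pt (t i)) + sgn u (eps j - pt (t j))).
    by exists i, j, s, u.
  exists (pt (x + sgn s (t i) + sgn u (t j))).
    by exists (x + sgn s (t i) + sgn u (t j)) => //; exact: hL.
  rewrite !ptD !ptS; vring.
- case: vB => i [s ->]; right.
  exists (sgn s ((eps i - pt (t i)) *+ 2)); first by exists i, s.
  exists (pt (x + sgn s (t i *+ 2))).
    by exists (x + sgn s (t i *+ 2)) => //; exact: hE.
  rewrite ptD ptS pt2; vring.
Qed.

(** The frame eps_i - t_i has the triple (S', L', E') as soon as this triple absorbs
    the translations by t_i, for both signs. *)
Lemma framed_shift (t : 'I_l -> int * int) S L E S' L' E' :
  (forall i s x, S x <-> S' (x + sgn s (t i))) ->
  (forall (i j : 'I_l) s u x, (i < j)%N -> L x <-> L' (x + sgn s (t i) + sgn u (t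
    j))) ->
  (forall i s x, E x <-> E' (x + sgn s (t i *+ 2))) ->
  framed R G l S L E -> framed R G l S' L' E'.
Proof.
move=> hS hL hE [eps [a [b [gen GE RE]]]].
pose eps' i := eps i - (a *~ (t i).1 + b *~ (t i).2).
exists eps', a, b; split=> //.
  move=> U eU aU bU; apply: gen => // i.
  rewrite -(subrK (a *~ (t i).1 + b *~ (t i).2) (eps i)) memvD //; first exact: eU.
  by rewrite -!scaler_int memvD // memvZ.
rewrite RE; apply/seteqP; split.
  by apply: roots_over_shift => [i s x /hS|i j s u x ij /(hL i j s u x ij)|i s x /hE].
have sN s (y : int * int) : sgn s (- y) = - sgn s y by case: s.
have := @roots_over_shift eps' a b (fun i => - t i) S' L' E' S L E.
have -> : (fun i => eps' i - (a *~ (- t i).1 + b *~ (- t i).2)) = eps.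
  apply/funext => i; rewrite /eps' /=.
  by rewrite !mulrNz -opprD opprK subrK.
apply=> [i s x S'x|i j s u x ij L'x|i s x E'x]; rewrite ?mulNrn !sN.
- by apply/(hS i s); rewrite subrK.
- by apply/(hL i j s u) => //; rewrite addrAC !subrK.
- by apply/(hE i s); rewrite subrK.
Qed.

Definition translate (t : int * int) X : set (int * int) := [set x | X (x - t)].

Lemma periods_iff (V : zmodType) (X : set V) t x : periods X t -> X x <-> X (x + t).
Proof.
move=> h; split=> [/h[]//|/h[_]]; by rewrite addrK.
Qed.

Lemma periodsN (V : zmodType) (X : set V) t : periods X t -> periods X (- t).
Proof. exact: (subgroupN (periods_subgroup X)). Qed.

(** Moving all eps_i by the same vector leaves eps_i - eps_j unchanged; the
    hypotheses make the new sets independent of the signs. *)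
Lemma framed_translate t S L E : periods S (t *+ 2) -> periods L (t *+ 2) ->
  periods E (t *+ 4) ->
  framed R G l S L E -> framed R G l (translate t S) L (translate (t *+ 2) E).
Proof.
move=> sS sL sE; apply: (@framed_shift (fun=> t)).
- move=> i [] x; rewrite /translate /= ?addrK //.
  by rewrite -addrA -opprD -mulr2n; apply: periods_iff; exact: periodsN.
- move=> i j [] [] x ij; rewrite /= ?addrK ?subrK //.
    by rewrite -addrA -opprD -mulr2n; apply: periods_iff; exact: periodsN.
  by rewrite -addrA -mulr2n; apply: periods_iff.
- move=> i [] x; rewrite /translate /= ?addrK //.
  by rewrite -addrA -opprD -mulrnDr; apply: periods_iff; exact: periodsN.
Qed.

End Moves.

(** * Sets of lattice points given by parity tables *)

Section Tables.
Implicit Types (p q : int) (c : bool).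

Lemma parity (m : int) : exists k : int,
  (m = 2 * k /\ (2 %| m)%Z) \/ (m = 2 * k + 1 /\ ~~ (2 %| m)%Z).
Proof.
exists (m %/ 2)%Z; lia.
Qed.

Lemma evenDM (m k : int) : (2 %| m + 2 * k)%Z = (2 %| m)%Z.
Proof. lia. Qed.

(** The entry cuv of a two by two table, with u = 0 if [even1] and v = 0 if [even2] *)
Definition choose4 (c00 c10 c01 c11 even1 even2 : bool) : bool :=
  if even1 then (if even2 then c00 else c01) else (if even2 then c10 else c11).

(** The points (p m, q n) such that the entry cuv of the table is true, where u and v
    are the parities of m and n *)
Definition table p q c00 c10 c01 c11 : set (int * int) :=
  [set x | exists m n, x = (p * m, q * n) /\
     choose4 c00 c10 c01 c11 (2 %| m)%Z (2 %| n)%Z].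

Lemma table_periods p q c00 c10 c01 c11 m n :
  periods (table p q c00 c10 c01 c11) (p * (2 * m), q * (2 * n)).
Proof.
move=> _ [m' [n' [-> h]]]; split.
  exists (m' + 2 * m), (n' + 2 * n); split; first by rewrite !mulrDr.
  by rewrite !evenDM.
exists (m' + 2 * (- m)), (n' + 2 * (- n)); split; last by rewrite !evenDM.
by rewrite !mulrDr !mulrN.
Qed.

Definition grid p q := table p q true true true true.

Lemma Zab_grid p q : Zab p q = grid p q.
Proof.
apply/seteqP; split=> [_ [[m n] _ <-]|_ [m [n [-> _]]]].
  by exists m, n; split=> //=; case: (2 %| m)%Z; case: (2 %| n)%Z.
by exists (m, n).
Qed.

Lemma table_even1 p q : table p q true false true false = grid (p * 2) q.
Proof.
apply/seteqP; split=> [_ [m [n [-> h]]]|_ [m [n [-> _]]]].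
  have [k [[-> _]|[_ mo]]] := parity m.
    by exists k, n; rewrite mulrA; split=> //; case: (2 %| k)%Z; case: (2 %| n)%Z.
  by move: h; rewrite /choose4 (negPf mo); case: (2 %| n)%Z.
exists (2 * m), n; rewrite mulrA; split=> //.
by rewrite dvdz_mulr //; case: (2 %| n)%Z.
Qed.

Lemma table_even2 p q : table p q true true false false = grid p (q * 2).
Proof.
apply/seteqP; split=> [_ [m [n [-> h]]]|_ [m [n [-> _]]]].
  have [k [[-> _]|[_ no]]] := parity n.
    by exists m, k; rewrite mulrA; split=> //; case: (2 %| k)%Z; case: (2 %| m)%Z.
  by move: h; rewrite /choose4 (negPf no); case: (2 %| m)%Z.
exists m, (2 * n); rewrite mulrA; split=> //.
by rewrite dvdz_mulr //; case: (2 %| m)%Z.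
Qed.

Lemma table_even p q : table p q true false false false = grid (p * 2) (q * 2).
Proof.
rewrite -table_even1; apply/seteqP; split=> [_ [m [n [-> h]]]|_ [m [n [-> h]]]].
  have [k [[nE _]|[_ no]]] := parity n.
    exists m, k; rewrite nE mulrA; split=> //.
    by move: h; case: (2 %| k)%Z; case: (2 %| m)%Z; case: (2 %| n)%Z.
  by move: h; rewrite /choose4 (negPf no); case: (2 %| m)%Z.
exists m, (2 * n); rewrite mulrA; split=> //.
by move: h; rewrite /choose4 dvdz_mulr //; case: (2 %| n)%Z; case: (2 %| m)%Z.
Qed.

Lemma even_mul (x y : int) : (2 %| x * y)%Z = (2 %| x)%Z || (2 %| y)%Z.
Proof. by rewrite !dvdzE abszM Euclid_dvdM. Qed.

Lemma even_sub1 (x : int) : (2 %| x - 1)%Z = ~~ (2 %| x)%Z.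
Proof. lia. Qed.

Lemma Lss_table p q (i j : int) c00 c10 c01 c11 :
  (forall m n : int, (2 %| (m - i) * (n - j))%Z = choose4 c00 c10 c01 c11 (2 %|
    m)%Z (2 %| n)%Z) ->
  Lss q p i j = table p q c00 c10 c01 c11.
Proof.
move=> h; apply/seteqP; split=> [_ [[m n] /= mn <-]|_ [m [n [-> mn]]]].
  by exists m, n; rewrite -h.
by exists (m, n); rewrite //= h.
Qed.

Lemma Lss00 p q : Lss q p 0 0 = table p q true true true false.
Proof.
apply: Lss_table => m n; rewrite !subr0 even_mul.
by case: (2 %| m)%Z; case: (2 %| n)%Z.
Qed.
Lemma Lss11 p q : Lss q p 1 1 = table p q false true true true.
Proof.
apply: Lss_table => m n; rewrite even_mul !even_sub1.
by case: (2 %| m)%Z; case: (2 %| n)%Z.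
Qed.
Lemma Lss01 p q : Lss q p 0 1 = table p q true false true true.
Proof.
apply: Lss_table => m n; rewrite subr0 even_mul !even_sub1.
by case: (2 %| m)%Z; case: (2 %| n)%Z.
Qed.
Lemma Lss10 p q : Lss q p 1 0 = table p q true true false true.
Proof.
apply: Lss_table => m n; rewrite subr0 even_mul !even_sub1.
by case: (2 %| m)%Z; case: (2 %| n)%Z.
Qed.

Lemma Ldiamond_table : Ldiamond = table 1 2 true false false true.
Proof.
have h (m n : int) : (m = n %[mod 2])%Z <-> choose4 true false false true (2 %|
  m)%Z (2 %| n)%Z.
  rewrite /choose4; split; case: ifP; case: ifP; lia.
apply/seteqP; split=> [_ [[m n] /= /h mn <-]|_ [m [n [-> /h mn]]]].
  by exists m, n; rewrite mul1r.
by exists (m, n); rewrite //= mul1r.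
Qed.

(** A subset of the grid generated by (p, 0) and (0, q), with periods (2p, 0) and
    (0, 2q), is given by a table. *)
Lemma periodic_table p q (X : set (int * int)) :
  (forall x, X x -> exists m n, x = (p * m, q * n)) ->
  (forall m n, periods X (p * (2 * m), q * (2 * n))) ->
  X = table p q `[< X (0, 0) >] `[< X (p, 0) >] `[< X (0, q) >] `[< X (p, q) >].
Proof.
move=> h1 h2.
have E (m n u v : int) : X (p * (2 * m + u), q * (2 * n + v)) <-> X (p * u, q * v).
  have -> : (p * (2 * m + u), q * (2 * n + v)) = (p * u, q * v) + (p * (2 * m), q *
    (2 * n)).
    by rewrite !mulrDr [RHS]addrC.
  by apply: iff_sym; apply: periods_iff.
have eqX m n : X (p * m, q * n) <-> choose4 `[< X (0, 0) >] `[< X (p, 0) >] `[< X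
  (0, q) >] `[< X (p, q) >] (2 %| m)%Z (2 %| n)%Z.
  have [i [[mE me]|[mE me]]] := parity m; have [j [[nE ne]|[nE ne]]] := parity n;
  rewrite /choose4 ?me ?ne ?(negPf me) ?(negPf ne) mE nE.
  - by have := E i j 0 0; rewrite !addr0 !mulr0 => ->; split=> /asboolP.
  - by have := E i j 0 1; rewrite !addr0 !mulr0 mulr1 => ->; split=> /asboolP.
  - by have := E i j 1 0; rewrite !addr0 !mulr0 mulr1 => ->; split=> /asboolP.
  - by have := E i j 1 1; rewrite !mulr1 => ->; split=> /asboolP.
apply/seteqP; split=> [x Xx|_ [m [n [-> /eqX]]] //].
by have [m [n xE]] := h1 x Xx; exists m, n; split=> //; apply/eqX; rewrite -xE.
Qed.

(** For k q = p, the shear maps (p m, q n) to (p (m - n), q n) and so exchanges the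
    classes (0, 1) and (1, 1). *)
Lemma shear_table k p q c00 c10 c01 c11 : k * q = p ->
  shear k (table p q c00 c10 c01 c11) = table p q c00 c10 c11 c01.
Proof.
move=> kq; have ch (m n : int) : choose4 c00 c10 c01 c11 (2 %| m + n)%Z (2 %| n)%Z =
    choose4 c00 c10 c11 c01 (2 %| m)%Z (2 %| n)%Z.
  have -> : (2 %| m + n)%Z = ((2 %| m)%Z == (2 %| n)%Z) by lia.
  by case: (2 %| m)%Z; case: (2 %| n)%Z.
apply/seteqP; split=> [[x y] [m [n [[/= xE yE] h]]]|_ [m [n [-> h]]]].
  exists (m - n), n; split; last by rewrite -ch subrK.
  by rewrite mulrBr -xE yE -kq -mulrA addrK.
by exists (m + n), n; rewrite /= ch mulrDr mulrA kq.
Qed.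

Lemma mem_grid p q m n : grid p q (p * m, q * n).
Proof. by exists m, n; split=> //; case: (2 %| m)%Z; case: (2 %| n)%Z. Qed.

Lemma grid_periods p q m n : periods (grid p q) (p * m, q * n).
Proof.
have full u v : choose4 true true true true (2 %| u)%Z (2 %| v)%Z.
  by case: (2 %| u)%Z; case: (2 %| v)%Z.
move=> _ [m' [n' [-> _]]]; split.
  by exists (m' + m), (n' + n); rewrite !mulrDr.
by exists (m' - m), (n' - n); rewrite !mulrBr.
Qed.

Lemma grid11 : grid 1 1 = setT.
Proof.
apply/seteqP; split=> // [[m n] _]; exists m, n; rewrite !mul1r; split=> //.
by case: (2 %| m)%Z; case: (2 %| n)%Z.
Qed.

Lemma translate_table1 p q c00 c10 c01 c11 :
  translate (p, 0) (table p q c00 c10 c01 c11) = table p q c10 c00 c11 c01.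
Proof.
have ch (m n : int) : choose4 c00 c10 c01 c11 (2 %| m - 1)%Z (2 %| n)%Z =
    choose4 c10 c00 c11 c01 (2 %| m)%Z (2 %| n)%Z.
  by rewrite even_sub1; case: (2 %| m)%Z; case: (2 %| n)%Z.
apply/seteqP; split=> [[x y] [m [n [[/= xE yE] h]]]|_ [m [n [-> h]]]].
  exists (m + 1), n; split; last by rewrite -ch addrK.
  by rewrite mulrDr mulr1 -xE -yE subrK subr0.
exists (m - 1), n; rewrite ch; split=> //.
by rewrite mulrBr mulr1 -[q * n in RHS]subr0.
Qed.

Lemma translate_table2 p q c00 c10 c01 c11 :
  translate (0, q) (table p q c00 c10 c01 c11) = table p q c01 c11 c00 c10.
Proof.
have ch (m n : int) : choose4 c00 c10 c01 c11 (2 %| m)%Z (2 %| n - 1)%Z =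
    choose4 c01 c11 c00 c10 (2 %| m)%Z (2 %| n)%Z.
  by rewrite even_sub1; case: (2 %| m)%Z; case: (2 %| n)%Z.
apply/seteqP; split=> [[x y] [m [n [[/= xE yE] h]]]|_ [m [n [-> h]]]].
  exists m, (n + 1); split; last by rewrite -ch addrK.
  by rewrite mulrDr mulr1 -xE -yE subrK subr0.
exists m, (n - 1); rewrite ch; split=> //.
by rewrite mulrBr mulr1 -[p * m in RHS]subr0.
Qed.

End Tables.

(** * Reduction to the listed triples *)

Section Classification.
Variables (K : realType) (F : vectType K) (R : set F) (G : {vspace F}) (l : nat).
Hypothesis l0 : (0 < l)%N.
Let frm := framed R G l.

Definition listed_triple (S L E : set (int * int)) :=
  [\/ BCC_triple l S L E, CvBC_triple l S L E, (1 < l)%N /\ BBv_triple l S L E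
    | CvC_triple l S L E].

Definition classified := exists S L E, frm S L E /\ listed_triple S L E.

Lemma classified_eq S L E S' L' E' : frm S' L' E' -> listed_triple S L E ->
  S = S' -> L = L' -> E = E' -> classified.
Proof. by move=> h hl eS eL eE; exists S, L, E; split=> //; rewrite eS eL eE. Qed.

Lemma LambdaE : Lambda = grid 1 1. Proof. exact: Zab_grid. Qed.
Lemma LijE i j : Lij i j = Lss 1 1 i j. Proof. by []. Qed.

(** The tactics below close a case with a given constructor, after writing the listed
    sets as tables. *)
Ltac normalize := rewrite ?LambdaE ?LijE ?Zab_grid ?Lss00 ?Lss11 ?Lss01 ?Lss10
  ?Ldiamond_table ?table_even1 ?table_even2 ?table_even; reflexivity.
Ltac bcc h c := eapply (classified_eq h); [constructor 1; (apply: c);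
  auto | normalize ..].
Ltac cvbc h c := eapply (classified_eq h); [constructor 2; (apply: c);
  auto | normalize ..].
Ltac bbv h c := eapply (classified_eq h); [constructor 3; split; [auto|(apply: c);
  auto] | normalize ..].
Ltac cvc h c := eapply (classified_eq h); [constructor 4; (apply: c);
  auto | normalize ..].

(** L = Lambda *)
Lemma classify_full e10 e01 e11 :
  (l = 1%N -> [|| e10 && e01, e10 && e11 | e01 && e11]) ->
  frm (grid 1 1) (grid 1 1) (table 1 1 true e10 e01 e11) -> classified.
Proof.
move=> l1 h.
have h' : frm (grid 1 1) (grid 1 1) (table 1 1 true e10 e11 e01).
  by have := framed_shear 1 h; rewrite /grid !shear_table.
have l2 : ~~ [|| e10 && e01, e10 && e11 | e01 && e11] -> (1 < l)%N.
  by move=> ne; rewrite ltn_neqAle l0 andbT eq_sym; apply: contraNneq ne => /l1.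
case: e10 e01 e11 l1 l2 h h' => [] [] [] _ l2 h h'.
- bcc h BCC1.
- bcc h BCC1_star0.
- bcc h' BCC1_star0.
- bbv h BBv1.
- bcc h BCC1_star0'.
- bcc h BCC2_1.
- bcc h' BCC2_1.
- bbv h BBv2_1.
Qed.

(** L is the sublattice 2Za + Zb. *)
Lemma classify_transverse e10 e01 e11 :
  (l = 1%N -> e01 || e11) ->
  frm (grid 1 1) (grid 2 1) (table 2 1 true e10 e01 e11) -> classified.
Proof.
move=> l1 h.
have h' : frm (grid 1 1) (grid 2 1) (table 2 1 true e10 e11 e01).
  by have := framed_shear 2 h; rewrite grid11 /grid !shear_table.
have ht : frm (grid 1 1) (grid 2 1) (table 2 1 e10 true e11 e01).
  have := @framed_translate _ _ _ _ _ (1, 0) _ _ _ _ _ _ h.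
  rewrite grid11 (translate_table1 2 1); apply=> //.
  - exact: (@grid_periods 2 1 1 0).
  - exact: (@table_periods 2 1 _ _ _ _ 1 0).
have l2 : ~~ (e01 || e11) -> (1 < l)%N.
  by move=> ne; rewrite ltn_neqAle l0 andbT eq_sym; apply: contraNneq ne => /l1.
case: e10 e01 e11 l1 l2 h h' ht => [] [] [] _ l2 h h' ht.
- bcc h BCC2_2.
- bcc h (@BCC2_star l 0).
- bcc h' (@BCC2_star l 0).
- bbv h BBv2_2.
- bcc ht (@BCC2_star l 1).
- bcc h BCC4.
- bcc h' BCC4.
- bbv h BBv4.
Qed.

(** L is the sublattice Za + 2Zb. *)
Lemma classify_parallel e10 e01 e11 :
  (l = 1%N -> e10 || e11) ->
  frm (grid 1 1) (grid 1 2) (table 1 2 true e10 e01 e11) -> classified.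
Proof.
move=> l1 h.
have ht : frm (grid 1 1) (grid 1 2) (table 1 2 e01 e11 true e10).
  have := @framed_translate _ _ _ _ _ (0, 1) _ _ _ _ _ _ h.
  rewrite grid11 (translate_table2 1 2); apply=> //.
  - exact: (@grid_periods 1 2 0 1).
  - exact: (@table_periods 1 2 _ _ _ _ 0 1).
have l2 : ~~ (e10 || e11) -> (1 < l)%N.
  by move=> ne; rewrite ltn_neqAle l0 andbT eq_sym; apply: contraNneq ne => /l1.
case: e10 e01 e11 l1 l2 h ht => [] [] [] _ l2 h ht.
- cvc h CvC1.
- cvc h (@CvC1_star l 0).
- cvc ht (@CvC1_star l 1).
- cvbc h CvBC1.
- cvc ht (@CvC1_star l 0).
- cvc h CvC2_1.
- cvc h CvC2_diamond.
- cvbc h CvBC2_1.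
Qed.

(** L = 2 Lambda. The pair (S, E / 2) of sets of classes modulo 2 Lambda is considered
    up to simultaneous translations and the exchange of b and a + b. *)
Section Double.
Let double s00 s10 s01 s11 e00 e10 e01 e11 :=
  frm (table 1 1 s00 s10 s01 s11) (grid 2 2) (table 2 2 e00 e10 e01 e11).

Lemma double_shear s00 s10 s01 s11 e00 e10 e01 e11 :
  double s00 s10 s01 s11 e00 e10 e01 e11 -> double s00 s10 s11 s01 e00 e10 e11 e01.
Proof. by move=> /(framed_shear 1); rewrite /double /grid !shear_table. Qed.

Lemma double_translate1 s00 s10 s01 s11 e00 e10 e01 e11 :
  double s00 s10 s01 s11 e00 e10 e01 e11 -> double s10 s00 s11 s01 e10 e00 e11 e01.
Proof.
move=> h; have := @framed_translate _ _ _ _ _ (1, 0) _ _ _ _ _ _ h.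
rewrite (translate_table1 1 1) (translate_table1 2 2); apply.
- exact: (@table_periods 1 1 _ _ _ _ 1 0).
- exact: (@grid_periods 2 2 1 0).
- exact: (@table_periods 2 2 _ _ _ _ 1 0).
Qed.

Lemma double_translate2 s00 s10 s01 s11 e00 e10 e01 e11 :
  double s00 s10 s01 s11 e00 e10 e01 e11 -> double s01 s11 s00 s10 e01 e11 e00 e10.
Proof.
move=> h; have := @framed_translate _ _ _ _ _ (0, 1) _ _ _ _ _ _ h.
rewrite (translate_table2 1 1) (translate_table2 2 2); apply.
- exact: (@table_periods 1 1 _ _ _ _ 0 1).
- exact: (@grid_periods 2 2 0 1).
- exact: (@table_periods 2 2 _ _ _ _ 0 1).
Qed.

Lemma classify_double_full e10 e01 e11 :
  double true true true true true e10 e01 e11 -> classified.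
Proof.
move=> h; have h' := double_shear h; have ht := double_translate2 h.
case: e10 e01 e11 h h' ht => [] [] [] h h' ht.
- cvc h CvC2_2.
- cvc h CvC2_star_l.
- cvc h' CvC2_star_l.
- cvbc h CvBC2_2.
- cvc ht CvC2_star_l.
- cvc h CvC4.
- cvc h' CvC4.
- cvbc h CvBC4.
Qed.

(** The class missing from S is that of (1, 1); the first hypothesis says that S meets
    E / 2. *)
Lemma classify_double_punctured e00 e10 e01 e11 : [|| e00, e10 | e01] ->
  double true true true false e00 e10 e01 e11 -> classified.
Proof.
move=> ne h; have hs := double_shear h.
have ha := double_translate1 h; have hb := double_translate2 h.
have hab := double_translate2 ha.
have hsa := double_translate1 hs; have habs := double_shear hab.
case: e00 e10 e01 e11 ne h hs ha hb hab hsa habs => [] [] [] [] // _ h hs ha hb hab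
  hsa habs.
- cvc h CvC2_star_s.
- cvc h CvC2_star0.
- cvc h CvC2_star1'.
- cvbc h (@CvBC2_star l 0).
- cvc hsa CvC2_star1.
- cvc h (@CvC4_star l 0).
- cvc habs (@CvC4_star l 1).
- cvbc h CvBC4_star0.
- cvc h CvC2_star1.
- cvc hsa (@CvC4_star l 0).
- cvc hab (@CvC4_star l 1).
- cvbc hsa CvBC4_star0.
- cvbc hab (@CvBC2_star l 1).
- cvbc hb CvBC4_star0'.
Qed.

Lemma classify_double s10 s01 s11 e10 e01 e11 :
  [|| s10 && s01, s10 && s11 | s01 && s11] ->
  double true s10 s01 s11 true e10 e01 e11 -> classified.
Proof.
case: s10 s01 s11 => [] [] [] // _ h.
- exact: classify_double_full h.
- exact: classify_double_punctured h.
- by apply: classify_double_punctured (double_shear h).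
- by apply: classify_double_punctured (double_translate2 h); rewrite /= !orbT.
Qed.
End Double.

(** If l = 2, L may be the union of three classes modulo 2 Lambda. Moving eps_0 alone
    by b translates L, and so changes the class that is missing from L. *)
Lemma classify_three_classes l10 l01 l11 : l = 2%N ->
  [|| l10 && l01, l10 && l11 | l01 && l11] -> ~~ [&& l10, l01 & l11] ->
  frm (grid 1 1) (table 1 1 true l10 l01 l11) (grid 2 2) -> classified.
Proof.
move=> l2 n1 n2 h.
have l1 : (1 < l)%N by rewrite l2.
have hs : frm (grid 1 1) (table 1 1 true l10 l11 l01) (grid 2 2).
  by have := framed_shear 1 h; rewrite grid11 /grid !shear_table.
have hb : frm (grid 1 1) (table 1 1 l01 l11 true l10) (grid 2 2).
  pose t (i : 'I_l) : int * int := if i == 0%N :> nat then (0, 1) else 0.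
  have E (X : set (int * int)) x y : periods X y -> X x <-> X (x + y) by exact:
    periods_iff.
  have tE i : t i = (0, 1) \/ t i = 0 by rewrite /t; case: ifP; [left|right].
  apply: (@framed_shift _ _ _ _ _ t) h => [i s x|i j s u x ij|i s x].
  - by rewrite grid11.
  - rewrite -translate_table2.
    have j0 : t j = 0 by rewrite /t; case: eqP ij => // ->.
    have i1 : t i = (0, 1).
      by rewrite /t; case: eqP => // i0; have := ltn_ord j; lia.
    have sg0 (v : bool) : sgn v (0 : int * int) = 0 by case: v; rewrite /= ?oppr0.
    rewrite j0 i1 sg0 addr0 /translate /=.
    case: s; rewrite /= ?addrK //.
    have -> : x + (0, 1) = (x - (0, 1)) + (0, 1) *+ 2 by rewrite mulr2n addrA subrK.
    apply: periods_iff; exact: (@table_periods 1 1 _ _ _ _ 0 1).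
  - apply: periods_iff; case: s => /=; [apply: periodsN|];
    by case: (tE i) => ->;
      [exact: (@grid_periods 2 2 0 1)|exact: (@grid_periods 2 2 0 0)].
case: l10 l01 l11 n1 n2 h hs hb => [] [] [] // _ _ h hs hb.
- bbv h BBv2_star.
- bbv hs BBv2_star.
- bbv hb BBv2_star.
Qed.

End Classification.

(** * The case analysis *)

Section Evenness.
Lemma even1_subgroup : is_subgroup [set x : int * int | (2 %| x.1)%Z].
Proof. by split=> [|x y] //= hx hy; rewrite rpredB. Qed.
Lemma even2_subgroup : is_subgroup [set x : int * int | (2 %| x.2)%Z].
Proof. by split=> [|x y] //= hx hy; rewrite rpredB. Qed.
Lemma even12_subgroup : is_subgroup [set x : int * int | (2 %| x.1 + x.2)%Z].
Proof. by split=> [|x y] //= hx hy; rewrite addrACA -opprD rpredB. Qed.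

Lemma table_sub_even1 q c00 c01 :
  table 1 q c00 false c01 false `<=` [set x | (2 %| x.1)%Z].
Proof.
move=> _ [m [n [-> h]]] /=; rewrite mul1r.
by move: h; rewrite /choose4; case: (2 %| m)%Z; case: (2 %| n)%Z.
Qed.
Lemma table_sub_even2 p c00 c10 :
  table p 1 c00 c10 false false `<=` [set x | (2 %| x.2)%Z].
Proof.
move=> _ [m [n [-> h]]] /=; rewrite mul1r.
by move: h; rewrite /choose4; case: (2 %| m)%Z; case: (2 %| n)%Z.
Qed.
Lemma table_sub_even12 c00 c11 :
  table 1 1 c00 false false c11 `<=` [set x | (2 %| x.1 + x.2)%Z].
Proof.
move=> _ [m [n [-> h]]] /=; rewrite !mul1r.
have -> : (2 %| m + n)%Z = ((2 %| m)%Z == (2 %| n)%Z) by lia.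
by move: h; rewrite /choose4; case: (2 %| m)%Z; case: (2 %| n)%Z.
Qed.

(** A union of classes modulo 2 Lambda that lies in none of the three subgroups of
    index 2 contains at least two of the three nonzero classes. *)
Lemma two_classes (c10 c01 c11 : bool) :
  (exists x, table 1 1 true c10 c01 c11 x /\ ~~ (2 %| x.1)%Z) ->
  (exists x, table 1 1 true c10 c01 c11 x /\ ~~ (2 %| x.2)%Z) ->
  (exists x, table 1 1 true c10 c01 c11 x /\ ~~ (2 %| x.1 + x.2)%Z) ->
  [|| c10 && c01, c10 && c11 | c01 && c11].
Proof.
move=> [x [hx nx]] [y [hy ny]] [z [hz nz]].
case: c10 c01 c11 hx hy hz => [] [] [] //.
- by move=> _ /table_sub_even2; rewrite /= (negPf ny).
- by move=> /table_sub_even1; rewrite /= (negPf nx).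
- by move=> _ _ /table_sub_even12; rewrite /= (negPf nz).
- by move=> /table_sub_even1; rewrite /= (negPf nx).
Qed.

Lemma not_subP (V : Type) (X : set V) (P : V -> bool) : ~ (X `<=` [set x | P x]) ->
  exists x, X x /\ ~~ P x.
Proof.
move=> nX; apply: contrapT => nx; apply: nX => x Xx /=.
by apply: contrapT => /negP nP; apply: nx; exists x.
Qed.
End Evenness.

Section Classify.
Variables (K : realType) (F : vectType K) (R : set F) (G : {vspace F}) (l : nat).
Hypothesis l0 : (0 < l)%N.

(** The case distinction is on which of the classes of (1, 0), (0, 1), (1, 1) modulo
    2 Lambda lie in L. *)
Lemma classify S L E : framed R G l S L E -> compatible l S L E -> classified R G l.
Proof.
move=> h [S0 L0 E0 gen S2 L2 E4 SL LE EL LL one].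
have dbl (m n : int) : (1 * (2 * m), 1 * (2 * n)) = (m, n) *+ 2.
  by rewrite mulr2n !mul1r !mulrDl !mul1r.
have table1 X : (forall x, periods X (x *+ 2)) ->
    X = table 1 1 `[< X (0, 0) >] `[< X (1, 0) >] `[< X (0, 1) >] `[< X (1, 1) >].
  move=> X2; apply: periodic_table => [[m n] _|m n]; last by rewrite dbl.
  by exists m, n; rewrite !mul1r.
have EsL : E `<=` L by move=> x /LE /(_ _ L0) [+ _]; rewrite add0r.
have Stwo : [|| `[< S (1, 0) >] && `[< S (0, 1) >], `[< S (1, 0) >] && `[< S (1, 1) >]
    | `[< S (0, 1) >] && `[< S (1, 1) >]].
  have SE := table1 S S2; rewrite (asboolT S0) in SE.
  apply: two_classes; rewrite -SE; apply: not_subP => sH.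
  - by have := gen _ even1_subgroup sH (1, 0).
  - by have := gen _ even2_subgroup sH (0, 1).
  - by have := gen _ even12_subgroup sH (1, 0).
(* A class of L outside 2 Lambda is a period of S. *)
have S_full : [\/ L (1, 0), L (0, 1) | L (1, 1)] -> S = grid 1 1.
  move=> Lx; rewrite (table1 S S2) (asboolT S0) /grid.
  have st (x : int * int) : L x -> forall y, (S y -> S (y + x)) /\ (S (y + x) -> S y).
    by move=> /SL hx y; split=> [/hx[]//|/hx[_]]; rewrite addrK.
  suff [s10 s01 s11] : [/\ S (1, 0), S (0, 1) & S (1, 1)] by rewrite !asboolT.
  case: Lx => /st hx.
  - have s10 : S (1, 0) by have := (hx 0).1 S0.
    have [i1 i2] := hx (0, 1).
    by case/or3P: Stwo => /andP[/asboolP u /asboolP v]; split=> //; auto.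
  - have s01 : S (0, 1) by have := (hx 0).1 S0.
    have [i1 i2] := hx (1, 0).
    by case/or3P: Stwo => /andP[/asboolP u /asboolP v]; split=> //; auto.
  - have s11 : S (1, 1) by have := (hx 0).1 S0.
    have i1 : S (0, 1) -> S (1, 0).
      by move=> /(hx (0, 1)).1 /(S2 (0, 1)) [_].
    have i2 : S (1, 0) -> S (0, 1).
      by move=> /(hx (1, 0)).1 /(S2 (1, 0)) [_].
    by case/or3P: Stwo => /andP[/asboolP u /asboolP v]; split=> //; auto.
have LT := table1 L L2; rewrite (asboolT L0) in LT.
have L_double : ~ L (1, 0) -> ~ L (0, 1) -> ~ L (1, 1) -> L = grid 2 2.
  by move=> n1 n2 n3; rewrite LT !asboolF // table_even.
have l_one H : l = 1%N -> is_subgroup H -> (forall x, H (x *+ 2)) -> ~ (L `<=` H)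
  -> ~ (E `<=` H).
  by move=> l1 sH H2 nLH EH; apply: nLH; apply: one.
have E1 (x : int * int) : (2 %| (x *+ 2).1)%Z by rewrite mulr2n /=; lia.
have E2 (x : int * int) : (2 %| (x *+ 2).2)%Z by rewrite mulr2n /=; lia.
have E12 (x : int * int) : (2 %| (x *+ 2).1 + (x *+ 2).2)%Z by rewrite rpredD.
have dblX (p q m n : int) : (p * (2 * m), q * (2 * n)) = (p * m, q * n) *+ 2.
  by apply: injective_projections; rewrite mulr2n /=; ring.
(* If L consists of three classes modulo 2 Lambda, no nonzero class is a period of L. *)
have three : [|| `[< L (1, 0) >] && `[< L (0, 1) >], `[< L (1, 0) >] && `[< L (1, 1) >]
      | `[< L (0, 1) >] && `[< L (1, 1) >]] ->
    ~~ [&& `[< L (1, 0) >], `[< L (0, 1) >] & `[< L (1, 1) >]] -> classified R G l.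
  move=> n2 n3.
  have Ltri : [\/ L (1, 0), L (0, 1) | L (1, 1)].
    by case/or3P: n2 => /andP[/asboolP u /asboolP v];
      [constructor 1|constructor 1|constructor 2].
  have not_st y : periods L y -> ~ [\/ y = (1, 0), y = (0, 1) | y = (1, 1)].
    move=> st yE; move/negP: n3; apply.
    have s0 : L y by have := (st _ L0).1; rewrite add0r.
    have sw x : (L x -> L (x + y)) /\ (L (x + y) -> L x).
      by split=> [/st[]//|/st[_]]; rewrite addrK.
    suff [? ? ?] : [/\ L (1, 0), L (0, 1) & L (1, 1)] by rewrite !asboolT.
    case: yE => yE; rewrite yE in s0 sw.
    - by have [i1 i2] := sw (0, 1); case/or3P: n2 => /andP[/asboolP u /asboolP v];
      split=> //; auto.
    - by have [i1 i2] := sw (1, 0); case/or3P: n2 => /andP[/asboolP u /asboolP v];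
      split=> //; auto.
    - have i1 : L (0, 1) -> L (1, 0) by move=> /(sw (0, 1)).1 /(L2 (0, 1)) [_].
      have i2 : L (1, 0) -> L (0, 1) by move=> /(sw (1, 0)).1 /(L2 (1, 0)) [_].
      by case/or3P: n2 => /andP[/asboolP u /asboolP v]; split=> //; auto.
  have l2 : l = 2%N.
    apply: contrapT => /LL Lst.
    case: Ltri => /Lst /not_st; apply; [constructor 1|constructor 2|constructor 3];
      done.
  pose H := [set x : int * int | periods E (x *+ 2)].
  have sH : is_subgroup H by exact/mulrn_subgroup/periods_subgroup.
  have HL x : L x -> H x by exact: EL.
  have H_all x : H x.
    have st y : periods H (y *+ 2).
      have Hy : H (y *+ 2) by rewrite /H /= -mulrnA; exact: E4.
      by move=> z Hz; split; [exact: (subgroupD sH)|exact: (subgroupB sH)].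
    suff [h10 h01 h11] : [/\ H (1, 0), H (0, 1) & H (1, 1)].
      by rewrite (table1 H st) !asboolT -?/(grid 1 1) ?grid11 //; exact: HL.
    case/or3P: n2 => /andP[/asboolP/HL u /asboolP/HL v]; split=> //.
    - exact: (subgroupD sH u v).
    - exact: (subgroupB sH v u).
    - exact: (subgroupB sH v u).
  have ET : E = grid 2 2.
    rewrite (table1 E H_all) (asboolT E0) !asboolF ?table_even // => /LE /not_st; apply;
    [constructor 3|constructor 2|constructor 1]; done.
  rewrite ET (S_full Ltri) LT in h.
  exact: classify_three_classes h.
(* Sublattices of index 2 that do not contain a, after a shear *)
have transverse k : shear k L = grid 2 1 -> (exists x, L x /\ ~~ (2 %| x.2)%Z) ->
    S = grid 1 1 -> classified R G l.
  move=> Lk [y [Ly ny]] ST.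
  have LkP m n : L (2 * m + k * n, n).
    have : shear k L (2 * m, n) by rewrite Lk; have := mem_grid 2 1 m n; rewrite mul1r.
    by [].
  have ET : shear k E = table 2 1 `[< shear k E (0, 0) >] `[< shear k E (2, 0) >]
                                   `[< shear k E (0, 1) >] `[< shear k E (2, 1) >].
    apply: periodic_table => [x /EsL Lx|m n].
      have : shear k L x by [].
      by rewrite Lk => -[m [n [-> _]]]; exists m, n.
    have st : periods E ((2 * m + k * n, n) *+ 2) by exact: EL.
    move=> z /st [z1 z2]; split; [move: z1|move: z2]; rewrite /shear /= mulr2n;
      congr (E (_, _)); rewrite /=; ring.
  have E00 : shear k E (0, 0) by rewrite /shear /= mulr0.
  rewrite (asboolT E00) in ET.
  have := framed_shear k h; rewrite ST Lk ET grid11 -(_ : grid 1 1 = setT) ?grid11 //.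
  rewrite -[shear k setT]grid11.
  apply: classify_transverse => // l1; apply: contrapT => /negP;
    rewrite negb_or => /andP[/negPf f1 /negPf f2].
  apply: (l_one [set x | (2 %| x.2)%Z] l1) => //; first exact: even2_subgroup.
    by move=> /(_ y Ly); rewrite /= (negPf ny).
  move=> x Ex; have : shear k E (x.1 - k * x.2, x.2).
    by rewrite /shear /= subrK; case: (x) Ex.
  by rewrite ET f1 f2 => /table_sub_even2.
have [La|nLa] := pselect (L (1, 0)); have [Lb|nLb] := pselect (L (0, 1));
  have [Lc|nLc] := pselect (L (1, 1)).
- have LE1 : L = grid 1 1 by rewrite LT !asboolT.
  have LA x : L x by rewrite LE1 grid11.
  have ET := table1 E (fun x => EL x (LA x)); rewrite (asboolT E0) in ET.
  rewrite (S_full (Or31 _ _ La)) LE1 ET in h.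
  apply: classify_full h => // l1.
  apply: two_classes; rewrite -ET; apply: not_subP; apply: l_one => //.
  + exact: even1_subgroup.
  + by move=> /(_ (1, 0) La).
  + exact: even2_subgroup.
  + by move=> /(_ (0, 1) Lb).
  + exact: even12_subgroup.
  + by move=> /(_ (1, 0) La).
- by apply: three; rewrite (asboolT La) (asboolT Lb) (asboolF nLc).
- by apply: three; rewrite (asboolT La) (asboolF nLb) (asboolT Lc).
- have Lp : L = grid 1 2 by rewrite LT (asboolT La) !asboolF // table_even2.
  have ET : E = table 1 2 `[< E (0, 0) >] `[< E (1, 0) >] `[< E (0, 2) >] `[< E (1,
    2) >].
    apply: periodic_table => [x /EsL|m n].
      by rewrite Lp => -[m [n [-> _]]]; exists m, n.
    by rewrite dblX; apply: EL; rewrite Lp; exact: mem_grid.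
  rewrite (asboolT E0) in ET.
  rewrite (S_full (Or31 _ _ La)) Lp ET in h.
  apply: classify_parallel h => // l1; apply: contrapT => /negP;
    rewrite negb_or => /andP[/negPf f1 /negPf f2].
  apply: (l_one [set x | (2 %| x.1)%Z] l1) => //; first exact: even1_subgroup.
    by move=> /(_ (1, 0) La).
  by rewrite ET f1 f2; exact: table_sub_even1.
- by apply: three; rewrite (asboolF nLa) (asboolT Lb) (asboolT Lc).
- apply: (transverse 0); last by apply: S_full; constructor 2.
    have -> : shear 0 L = L by apply/seteqP; split=> -[m n];
      rewrite /shear /= mul0r addr0.
    by rewrite LT (asboolT Lb) !asboolF // table_even1.
  by exists (0, 1).
- apply: (transverse 1); last by apply: S_full; constructor 3.
    by rewrite LT (asboolT Lc) !asboolF // shear_table // table_even1.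
  by exists (1, 1).
- have Ld := L_double nLa nLb nLc.
  have ET : E = table 2 2 `[< E (0, 0) >] `[< E (2, 0) >] `[< E (0, 2) >] `[< E (2,
    2) >].
    apply: periodic_table => [x /EsL|m n].
      by rewrite Ld => -[m [n [-> _]]]; exists m, n.
    have -> : (2 * (2 * m), 2 * (2 * n)) = (m, n) *+ 4.
      by apply: injective_projections; rewrite !mulrS mulr0n /=; ring.
    exact: E4.
  have ST := table1 S S2; rewrite (asboolT S0) in ST; rewrite (asboolT E0) in ET.
  rewrite ST Ld ET in h.
  exact: classify_double h.
Qed.
End Classify.

(** * Isomorphisms with the models *)

Lemma roots_over_image (V W : zmodType) (f : {additive V -> W}) l (eps : 'I_l -> V)
    (S L E : set V) :
  f @` roots_over eps S L E =
  roots_over (f \o eps) (f @` S) (f @` L) (f @` E).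
Proof.
have fs s v : f (sgn s v) = sgn s (f v) by case: s; rewrite //= raddfN.
apply/seteqP; split=> [_ [_ [[|]|] [v vB [x Xx <-] <-]]|_ [[|]|] [v vB [_ [x Xx <-]
  <-]]].
- left; left; exists (f v); last by exists (f x); [exists x|rewrite raddfD].
  by case: vB => i [s ->]; exists i, s; rewrite fs.
- left; right; exists (f v); last by exists (f x); [exists x|rewrite raddfD].
  by case: vB => i [j [s [t [ij ->]]]]; exists i, j, s, t; rewrite raddfD !fs.
- right; exists (f v); last by exists (f x); [exists x|rewrite raddfD].
  by case: vB => i [s ->]; exists i, s; rewrite fs raddfMn.
- case: vB => i [s ->]; exists (sgn s (eps i) + x); last by rewrite raddfD fs.
  by left; left; exists (sgn s (eps i)); [exists i, s | exists x].
- case: vB => i [j [s [t [ij ->]]]].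
  exists (sgn s (eps i) + sgn t (eps j) + x); last by rewrite !raddfD !fs.
  left; right; exists (sgn s (eps i) + sgn t (eps j)); last by exists x.
  by exists i, j, s, t.
- case: vB => i [s ->]; exists (sgn s (eps i *+ 2) + x);
  last by rewrite raddfD fs raddfMn.
  by right; exists (sgn s (eps i *+ 2)); [exists i, s | exists x].
Qed.

Lemma pts_image (V W : zmodType) (f : {additive V -> W}) (a b : V) X :
  f @` pts a b X = pts (f a) (f b) X.
Proof.
apply/seteqP; split=> [_ [_ [x Xx <-] <-]|_ [x Xx <-]].
  by exists x => //; rewrite raddfD !raddfMz.
by exists (a *~ x.1 + b *~ x.2); [exists x | rewrite raddfD !raddfMz].
Qed.

Section CoordRow.
Variables (K : realType) (F : vectType K) (m n : nat).
Variables (f : 'I_m -> 'I_n) (X : n.-tuple F).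

(** The row of the coordinates of x in the basis X, selected and ordered by f *)
Definition coord_row (x : F) : 'rV[K]_m := \row_i coord X (f i) x.

Fact coord_row_is_linear : linear coord_row.
Proof. by move=> c x y; apply/rowP => i; rewrite !mxE linearP. Qed.
HB.instance Definition _ := GRing.isLinear.Build K F 'rV[K]_m _ coord_row
  coord_row_is_linear.

Lemma coord_row_basis (X_free : free X) j :
  coord_row X`_j = \row_i (j == f i :> nat)%:R.
Proof.
apply/rowP => i; rewrite !mxE.
have [jn|nj] := ltnP j n; first exact: (coord_free (Ordinal jn)).
rewrite nth_default ?size_tuple // linear0.
by have [e|//] := eqVneq j (f i); have := ltn_ord (f i); rewrite -e ltnNge nj.
Qed.
End CoordRow.

Section Frames.
Variables (K : realType) (F : vectType K) (R : set F) (G : {vspace F}) (l : nat).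
Hypothesis dF : \dim {:F} = (l + 2)%N.

(** The tuple eps_1, .., eps_l, b, a, in the order of the coordinates of the models *)
Definition frame_basis (eps : 'I_l -> F) (a b : F) : (l + 2).-tuple F :=
  [tuple match split i with
         | inl j => eps j
         | inr k => if k == 0 then b else a
         end | i < l + 2].

Section OneFrame.
Variables (eps : 'I_l -> F) (a b : F).
Hypothesis gen : forall U : {vspace F},
  (forall i, eps i \in U) -> a \in U -> b \in U -> U = fullv.
Let X := frame_basis eps a b.

Lemma frame_basis_eps i : X`_(lshift 2 i) = eps i.
Proof.
rewrite -(tnth_nth 0 X (lshift 2 i)) tnth_mktuple.
by have := unsplitK (inl i : 'I_l + 'I_2); rewrite /= => ->.
Qed.
Lemma frame_basis_b : X`_(rshift l (0 : 'I_2)) = b.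
Proof.
rewrite -(tnth_nth 0 X (rshift l 0)) tnth_mktuple.
by have := unsplitK (inr 0 : 'I_l + 'I_2); rewrite /= => ->.
Qed.
Lemma frame_basis_a : X`_(rshift l (1 : 'I_2)) = a.
Proof.
rewrite -(tnth_nth 0 X (rshift l 1)) tnth_mktuple.
by have := unsplitK (inr 1 : 'I_l + 'I_2); rewrite /= => ->.
Qed.

Lemma frame_basisP : basis_of fullv X.
Proof.
rewrite basisEdim size_tuple dF leqnn andbT.
have inX i : X`_i \in <<X>>%VS.
  have [il|li] := ltnP i (l + 2); first by rewrite memv_span // mem_nth // size_tuple.
  by rewrite nth_default ?mem0v // size_tuple.
suff -> : <<X>>%VS = fullv by rewrite subvv.
apply: gen => [i||].
- by rewrite -frame_basis_eps.
- by rewrite -frame_basis_a.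
- by rewrite -frame_basis_b.
Qed.

Let X_free : free X := basis_free frame_basisP.

Lemma frame_mers_iso S L E : G = <[a]>%VS ->
  R = roots_over eps (pts a b S) (pts a b L) (pts a b E) ->
  mers_iso R G (ell_roots K l S L E) (ell_marking K l).
Proof.
move=> GE RE; pose f : 'I_(l + 2) -> 'I_(l + 2) := id.
have fX i : coord_row f X X`_(i : 'I_(l + 2)) = delta_mx 0 i.
  by rewrite coord_row_basis //; apply/rowP => j; rewrite !mxE eqxx eq_sym.
have fa : coord_row f X a = ell_a K l by rewrite /ell_a -fX frame_basis_a.
have fb : coord_row f X b = ell_b K l by rewrite /ell_b -fX frame_basis_b.
exists (linfun (coord_row f X)); split.
- exists (fun v : 'rV[K]_(l + 2) => \sum_i v 0 i *: X`_i) => [x|v].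
    rewrite lfunE [RHS](coord_basis frame_basisP (memvf x)).
    by apply: eq_bigr => i _; rewrite mxE.
  by apply/rowP => i; rewrite lfunE mxE coord_sum_free.
- have -> : (linfun (coord_row f X) : F -> _) = coord_row f X by apply/funext => x;
  rewrite lfunE.
  rewrite RE roots_over_image !pts_image /= fa fb /ell_roots; congr roots_over.
  by apply/funext => i; rewrite /= /ell_eps -fX frame_basis_eps.
- by rewrite GE limg_line lfunE /= fa.
Qed.

(** The second coordinates of the points of X are the multiples of k. *)
Definition snd_image (X : set (int * int)) (k : int) :=
  [set x.2 | x in X] = [set k * n | n in setT].

(** Dropping the coordinate of a induces an isomorphism from F / G to the space of the
    affine models. *)
Lemma frame_quotient_iso S L E (kS kL kE : int) : G = <[a]>%VS ->
  R = roots_over eps (pts a b S) (pts a b L) (pts a b E) ->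
  snd_image S kS -> snd_image L kL -> snd_image E kE ->
  root_system_iso (quotient_roots R G)
    (roots_over (@aff_eps K l) (@aff_Zb K l kS) (@aff_Zb K l kL) (@aff_Zb K l kE)).
Proof.
move=> GE RE hS hL hE.
have l12 : (l + 1 <= l + 2)%N by rewrite leq_add2l.
pose f : 'I_(l + 1) -> 'I_(l + 2) := widen_ord l12.
pose psi := coord_row f X.
have fX (i : 'I_(l + 1)) : psi X`_i = delta_mx 0 i.
  by rewrite /psi coord_row_basis //; apply/rowP => j; rewrite !mxE eqxx eq_sym.
have psi_a : psi a = 0.
  rewrite -frame_basis_a /psi coord_row_basis //; apply/rowP => j; rewrite !mxE /=.
  by rewrite gtn_eqF ?ltn_ord.
have psi_b : psi b = aff_b K l by rewrite -frame_basis_b (fX (rshift l 0)).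
have psi_eps i : psi (eps i) = aff_eps K i by rewrite -frame_basis_eps (fX (lshift
  1 i)).
have psi0 x : psi x = 0 -> x \in G.
  move=> px; rewrite (coord_basis frame_basisP (memvf x)) GE memv_suml // => i _.
  have [il|li] := ltnP i (l + 1).
    have := congr1 (fun v : 'rV__ => v 0 (Ordinal il)) px; rewrite !mxE.
    rewrite (_ : f _ = i); last exact: val_inj.
    by move=> ->; rewrite scale0r mem0v.
  have -> : i = rshift l 1 by apply: val_inj; have := ltn_ord i; rewrite /=; lia.
  by rewrite frame_basis_a memvZ // memv_line.
have psiG x : x \in G -> psi x = 0.
  by rewrite GE => /vlineP [c ->]; rewrite /psi linearZ /= -/psi psi_a scaler0.
pose h : 'Hom(quotient_space G, affine_space K l) := linfun (psi \o vsval).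
have hq x : h (quotient_map G x) = psi x.
  have dxC : (G^C :&: G = 0)%VS by rewrite capvC capv_compl.
  have xT : x \in (G^C + G)%VS by rewrite addvC addv_complf memvf.
  rewrite lfunE /= /quotient_map vsprojK ?memv_pi //.
  rewrite -{2}(daddv_pi_add dxC xT) /psi linearD /= -/psi.
  by rewrite (psiG (daddv_pi G _ x)) ?addr0 // memv_pi.
pose g (v : affine_space K l) := quotient_map G (\sum_i v 0 i *: X`_(i : 'I_(l + 1))).
have gK : cancel g h.
  move=> v; rewrite /g hq /psi linear_sum /= [RHS]row_sum_delta.
  by apply: eq_bigr => i _; rewrite linearZ /= -/psi fX.
have h_inj : injective h.
  move=> u v huv; apply/eqP; rewrite -subr_eq0;
    have [x xE] := quotient_map_surj (u - v).
  rewrite -xE quotient_map_eq0; apply: psi0.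
  by rewrite -hq xE linearB /= huv subrr.
exists h; first by exists g => // u; apply: h_inj; rewrite gK.
have -> : h @` quotient_roots R G = psi @` R.
  apply/seteqP; split=> [_ [_ [x Rx <-] <-]|_ [x Rx <-]].
    by exists x; rewrite // hq.
  by exists (quotient_map G x); [exists x | rewrite hq].
rewrite RE roots_over_image !pts_image /= -/psi psi_a psi_b.
have ptsE Y k : snd_image Y k -> pts 0 (aff_b K l) Y = @aff_Zb K l k.
  move=> hY; apply/seteqP; split=> [_ [x Yx <-]|_ [n ->]].
    have : [set x.2 | x in Y] x.2 by exists x.
    by rewrite hY => -[n _ nE]; exists n; rewrite mul0rz add0r nE.
  have : [set k * n | n in setT] (k * n) by exists n.
  by rewrite -hY => -[x Yx xE]; exists x; rewrite // mul0rz add0r xE.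
rewrite (ptsE _ _ hS) (ptsE _ _ hL) (ptsE _ _ hE); congr roots_over.
by apply/funext => i /=; rewrite -/psi psi_eps.
Qed.
End OneFrame.

Lemma framed_iso_to_listed listed S L E :
  framed R G l S L E -> listed S L E -> iso_to_listed R G l listed.
Proof.
move=> [eps [a [b [gen GE RE]]]] hl; exists S, L, E; split=> //.
exact: (frame_mers_iso gen GE RE).
Qed.

Lemma framed_quotient_iso S L E kS kL kE : framed R G l S L E ->
  snd_image S kS -> snd_image L kL -> snd_image E kE ->
  root_system_iso (quotient_roots R G)
    (roots_over (@aff_eps K l) (@aff_Zb K l kS) (@aff_Zb K l kL) (@aff_Zb K l kE)).
Proof.
move=> [eps [a [b [gen GE RE]]]].
exact: (frame_quotient_iso gen GE RE).
Qed.
End Frames.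

Lemma snd_table p q (c00 c10 c01 c11 : bool) : c00 || c10 -> c01 || c11 ->
  snd_image (table p q c00 c10 c01 c11) q.
Proof.
move=> c0 c1; apply/seteqP; split=> [_ [_ [m [n [-> _]]] <-]|_ [n _ <-]].
  by exists n.
have [m hm] : exists m, choose4 c00 c10 c01 c11 (2 %| m)%Z (2 %| n)%Z.
  have [ne|no] := boolP (2 %| n)%Z.
    by case/orP: c0 => c0; [exists 0 | exists 1]; rewrite /choose4.
  by case/orP: c1 => c1; [exists 0 | exists 1]; rewrite /choose4.
exists (p * m, q * n) => //; by exists m, n.
Qed.

Lemma snd_Zab p q : snd_image (Zab p q) q.
Proof. by rewrite Zab_grid; apply: snd_table. Qed.

Theorem theorem4p2 (K : realType) (F : vectType K) (I : {symmetric F})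
    (l : nat) (R : set F) (G : {vspace F}) :
  (1 <= l)%N ->
  marked_elliptic_root_system l I R G ->
  ~ reduced R ->
  [\/ root_system_iso (quotient_roots R G) (aff_BCC K l) /\
        iso_to_listed R G l (BCC_triple l),
      root_system_iso (quotient_roots R G) (aff_CvBC K l) /\
        iso_to_listed R G l (CvBC_triple l),
      [/\ (2 <= l)%N,
          root_system_iso (quotient_roots R G) (aff_BBv K l)
        & iso_to_listed R G l (BBv_triple l)]
    | root_system_iso (quotient_roots R G) (aff_CvC K l) /\
        iso_to_listed R G l (CvC_triple l)].
Proof.
move=> l0 hm nR.
have dF : \dim {:F} = (l + 2)%N by case: hm => [[_ hs] _ _ _];
  exact: (dim_signature hs).
have [S0 [L0 [E0 [h0 hc]]]] := framed_compatible_exists l0 hm nR.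
have [S [L [E [h hl]]]] := classify l0 h0 hc.
have sLss q i j : (i = 0 \/ i = 1) -> (j = 0 \/ j = 1) -> forall p, snd_image (Lss
  q p i j) q.
  by case=> ->; case=> -> p; rewrite ?Lss00 ?Lss01 ?Lss10 ?Lss11; apply: snd_table.
have s0 : (0 : int) = 0 \/ (0 : int) = 1 by left.
have s1 : (1 : int) = 0 \/ (1 : int) = 1 by right.
have sdia : snd_image Ldiamond 2 by rewrite Ldiamond_table; apply: snd_table.
case: hl => [hl|hl|[l2 hl]|hl].
- constructor 1; split; last exact: (framed_iso_to_listed dF h).
  have [hS hL hE] : [/\ snd_image S 1, snd_image L 1 & snd_image E 1].
    by case: hl => *; split; try apply: snd_Zab; apply: sLss.
  exact: (framed_quotient_iso dF h hS hL hE).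
- constructor 2; split; last exact: (framed_iso_to_listed dF h).
  have [hS hL hE] : [/\ snd_image S 1, snd_image L 2 & snd_image E 4].
    by case: hl => *; split; try apply: snd_Zab; apply: sLss.
  exact: (framed_quotient_iso dF h hS hL hE).
- constructor 3; split=> //; last exact: (framed_iso_to_listed dF h).
  have [hS hL hE] : [/\ snd_image S 1, snd_image L 1 & snd_image E 2].
    by case: hl => *; split; try apply: snd_Zab; apply: sLss.
  exact: (framed_quotient_iso dF h hS hL hE).
- constructor 4; split; last exact: (framed_iso_to_listed dF h).
  have [hS hL hE] : [/\ snd_image S 1, snd_image L 2 & snd_image E 2].
    by case: hl => *; split; try apply: snd_Zab; try exact: sdia; apply: sLss.
  exact: (framed_quotient_iso dF h hS hL hE).
Qed.
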